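(* Let $K$ be a perfect field with $p=\operatorname{char}(K)\ge0$, let $n\ge1$, and let $\mathbb{X}$ be a 0-dimensional locally monomial Gorenstein scheme in $\mathbb{P}^n_K$ with support $\operatorname{Supp}(\mathbb{X})=\{p_1,\dots,p_s\}$ and homogeneous coordinate ring $R$. For $j=1,\dots,s$ write $\mathcal{O}_j\cong K[X_1,\dots,X_n]/\mathfrak{Q}_j$, where $\mathcal{O}_j$ is the local ring of $\mathbb{X}$ at $p_j$ and $\mathfrak{Q}_j=\langle X_1^{k_{1j}},\dots,X_n^{k_{nj}}\rangle$ with $k_{ij}\ge1$. For every $m\geq 0$, $1\le i_1<\cdots<i_m\le n$ and $1\le j\le s$, let $$\Gamma_{(i_1,\dots,i_m),j}=\{i\in\{i_1,\dots,i_m\} : p\nmid k_{ij}\}.$$ Then for every $m\ge1$, $$ \begin{aligned} \operatorname{HP}(\Omega^m_R)=\sum_{j=1}^s\Big[&\sum_{1\le i_1<\dots<i_{m-1}\le n}\ \prod_{i\notin\Gamma_{(i_1,\dots,i_{m-1}),j}}k_{ij}\prod_{i\in\Gamma_{(i_1,\dots,i_{m-1}),j}}(k_{ij}-1)\\ &+\sum_{1\le l_1<\dots<l_m\le n}\ \prod_{i\notin\Gamma_{(l_1,\dots,l_m),j}}k_{ij}\prod_{i\in\Gamma_{(l_1,\dots,l_m),j}}(k_{ij}-1)\Big]. \end{aligned} $$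
   Context: $P=K[X_0,\dots,X_n]$ is standard graded, $I_{\mathbb{X}}\subseteq P$ is the saturated homogeneous ideal defining the 0-dimensional (closed sub)scheme $\mathbb{X}$, and $R=P/I_{\mathbb{X}}$. $\operatorname{Supp}(\mathbb{X})$ is the set of closed points of $\mathbb{X}$. $\mathbb{X}$ is a locally monomial Gorenstein scheme if for each $j$ the local ring $\mathcal{O}_j$ of $\mathbb{X}$ at $p_j$ satisfies $\mathcal{O}_j\cong K[X_1,\dots,X_n]/\mathfrak{Q}_j$ (as $K$-algebras), where $\mathfrak{Q}_j$ is a monomial Gorenstein ideal generated by pure powers of the indeterminates. $\Omega^m_R=\Lambda^m_R\Omega^1_{R/K}$ is the $m$-th exterior power of the module of Kähler differentials of $R/K$, graded with $\deg(dx_i)=1$. $\operatorname{HP}(M)$ is the Hilbert polynomial of the finitely generated graded $R$-module $M$; here it is constant and identified with an integer. Conventions: in the products, the index $i$ ranges over $\{1,\dots,n\}$; empty sums are $0$ and empty products are $1$; for $m=1$ the first inner sum has exactly one summand, indexed by the empty tuple (with $\Gamma=\emptyset$). If $p=0$, then $p\nmid k$ for all $k\ge1$. *)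

(* Defs.v *)
From HB Require Import structures.
From mathcomp Require Import all_boot all_algebra all_field.
From mathcomp Require Import boolp.
From mathcomp Require Import freeg mpoly ring.

Set Implicit Arguments.
Unset Strict Implicit.
Unset Printing Implicit Defensive.

Import GRing.Theory.
Local Open Scope ring_scope.
Local Open Scope quotient_scope.

Definition perfect_field (K : fieldType) : Prop :=
  forall q : {poly K}, irreducible_poly q -> separable_poly q.

Definition field_char (K : fieldType) (p : nat) : Prop :=
  (p \in [pchar K]) \/ (p = 0%N /\ [pchar K] =i pred0).

(* A / I as a K-algebra; [ring_quotient] only provides its ring structure. *)
Section QuotientAlgebra.
Variables (K : fieldType) (A : comAlgType K) (I : idealr A).

Definition quot_alg : Type := {ideal_quot I}.
HB.instance Definition _ := GRing.ComNzRing.on quot_alg.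

Definition quot_pi (a : A) : quot_alg := \pi_({ideal_quot I}) a.

Lemma quot_piD a b : quot_pi (a + b) = quot_pi a + quot_pi b.
Proof. exact: (raddfD \pi_({ideal_quot I})). Qed.

Lemma quot_piM a b : quot_pi (a * b) = quot_pi a * quot_pi b.
Proof. exact: (rmorphM \pi_({ideal_quot I})). Qed.

Lemma quot_pi1 : quot_pi 1 = 1.
Proof. exact: (rmorph1 \pi_({ideal_quot I})). Qed.

Lemma quot_pi_eq0 a : (quot_pi a == 0) = (a \in I).
Proof.
by rewrite -(raddf0 \pi_({ideal_quot I})) -Quotient.idealrBE subr0.
Qed.

Lemma quot_pi_surj (x : quot_alg) : exists a, x = quot_pi a.
Proof. by exists (repr x); rewrite /quot_pi reprK. Qed.

Definition quot_scale (k : K) (x : quot_alg) : quot_alg := quot_pi k%:A * x.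

Fact quot_scaleA k l x : quot_scale k (quot_scale l x) = quot_scale (k * l) x.
Proof. by rewrite /quot_scale mulrA -quot_piM -scalerAl mul1r scalerA. Qed.
Fact quot_scale1 : left_id 1 quot_scale.
Proof. by move=> x; rewrite /quot_scale scale1r quot_pi1 mul1r. Qed.
Fact quot_scaleDr : right_distributive quot_scale +%R.
Proof. by move=> k x y; rewrite /quot_scale mulrDr. Qed.
Fact quot_scaleDl x : {morph quot_scale^~ x : k l / k + l}.
Proof. by move=> k l; rewrite /quot_scale scalerDl quot_piD mulrDl. Qed.
HB.instance Definition _ := GRing.Zmodule_isLmodule.Build K quot_alg
  quot_scaleA quot_scale1 quot_scaleDr quot_scaleDl.

Fact quot_scaleAl (k : K) (x y : quot_alg) : k *: (x * y) = k *: x * y.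
Proof. exact: mulrA. Qed.
HB.instance Definition _ :=
  GRing.Lmodule_isLalgebra.Build K quot_alg quot_scaleAl.
HB.instance Definition _ := GRing.Lalgebra_isComAlgebra.Build K quot_alg.

Lemma quot_piZ (k : K) a : quot_pi (k *: a) = k *: quot_pi a.
Proof. by rewrite -[k *: a]mul1r -scalerAr scalerAl quot_piM. Qed.

Lemma quot_pi_sum (N : nat) (f : 'I_N -> A) :
  quot_pi (\sum_i f i) = \sum_i quot_pi (f i).
Proof. exact: (raddf_sum \pi_({ideal_quot I})). Qed.

End QuotientAlgebra.

Record grading (K : fieldType) (A : comAlgType K) := Grading {
  gr_piece :> nat -> A -> Prop;
  gr_lin : forall d (k : K) a b,
    gr_piece d a -> gr_piece d b -> gr_piece d (k *: a + b);
  gr_0 : forall d, gr_piece d 0;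
  gr_1 : gr_piece 0%N 1;
  gr_M : forall d e a b,
    gr_piece d a -> gr_piece e b -> gr_piece (d + e)%N (a * b);
  gr_decomp : forall a, exists N (f : nat -> A),
    (forall i, gr_piece i (f i)) /\ a = \sum_(i < N) f i;
  gr_direct : forall N (f : nat -> A),
    (forall i, gr_piece i (f i)) -> \sum_(i < N) f i = 0 ->
    forall i, (i < N)%N -> f i = 0
}.

Section GradedAlgebra.
Variables (K : fieldType) (A : comAlgType K) (G : grading A).

Lemma gr_opp d a : G d a -> G d (- a).
Proof.
by move=> Ga; rewrite -[- a]addr0 -scaleN1r; apply: gr_lin => //; apply: gr_0.
Qed.

Lemma gr_add d a b : G d a -> G d b -> G d (a + b).
Proof. by move=> Ga Gb; rewrite -[a]scale1r; apply: gr_lin. Qed.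

Lemma gr_scale d k a : G d a -> G d (k *: a).
Proof. by move=> Ga; rewrite -[_ *: _]addr0; apply: gr_lin => //; apply: gr_0. Qed.

Definition homogeneous_ideal (I : {pred A}) : Prop :=
  forall N (f : nat -> A), (forall i, G i (f i)) ->
    \sum_(i < N) f i \in I -> forall i, (i < N)%N -> f i \in I.

Record proj_point := ProjPoint {
  pt_ideal :> prime_idealr A;
  pt_homogeneous : homogeneous_ideal pt_ideal;
  pt_relevant : exists d a, [/\ (0 < d)%N, G d a & a \notin pt_ideal]
}.

(* y lies in the closure of x in Proj A. *)
Definition specializes (x y : proj_point) : Prop :=
  {subset (x : {pred A}) <= (y : {pred A})}.

Definition closed_point (x : proj_point) : Prop :=
  forall y, specializes x y -> specializes y x.

(* There is a strict chain x_0 ~> x_1 ~> ... ~> x_d of specializations, i.e. a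
   strict chain of irreducible closed subsets of length d. *)
Definition proj_chain (d : nat) : Prop :=
  exists x : nat -> proj_point, forall i, (i < d)%N ->
    specializes (x i) (x i.+1) /\ ~ specializes (x i.+1) (x i).

Definition proj_dim (d : nat) : Prop :=
  proj_chain d /\ forall e, proj_chain e -> (e <= d)%N.

End GradedAlgebra.

(* The local ring of Proj A at x: fractions a / b with a, b homogeneous of the
   same degree and b not in x. *)
Section LocalRing.
Variables (K : fieldType) (A : comAlgType K) (G : grading A).
Variable (x : proj_point G).

Definition hfrac_axiom (u : A * A) : bool :=
  `[< exists d, G d u.1 /\ G d u.2 >] && (u.2 \notin x).

Record hfrac := HFrac { hfrac_val :> A * A; _ : hfrac_axiom hfrac_val }.
HB.instance Definition _ := [isSub for hfrac_val].
HB.instance Definition _ := [Choice of hfrac by <:].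

Lemma hfracP (u : hfrac) : exists d, G d u.1 /\ G d u.2.
Proof. by case: u => u /= /andP[/asboolP]. Qed.

Lemma hfrac_den (u : hfrac) : u.2 \notin x.
Proof. by case: u => u /= /andP[]. Qed.

Definition hfrac_equiv (u v : hfrac) : bool :=
  `[< exists d h, [/\ G d h, h \notin x & h * (u.1 * v.2 - v.1 * u.2) = 0] >].

Lemma pt_notinM a b : a \notin x -> b \notin x -> a * b \notin x.
Proof. by move=> xa xb; rewrite prime_idealrM negb_or xa. Qed.

Lemma pt_notin1 : 1 \notin x. Proof. by rewrite idealr1. Qed.

Lemma hfrac_equivI (u v : hfrac) : u.1 * v.2 = v.1 * u.2 -> hfrac_equiv u v.
Proof.
move=> e; apply/asboolP; exists 0%N, 1; split; [exact: gr_1|exact: pt_notin1|].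
by rewrite e subrr mulr0.
Qed.

Fact hfrac_equiv_is_equiv : equiv_class_of hfrac_equiv.
Proof.
split.
- by move=> u; apply: hfrac_equivI.
- suff S u v : hfrac_equiv u v -> hfrac_equiv v u.
    by move=> u v; apply/idP/idP; apply: S.
  move=> /asboolP[d [h [Gh xh e]]]; apply/asboolP; exists d, h; split=> //.
  by rewrite -opprB mulrN e oppr0.
- move=> v u w /asboolP[d [h [Gh xh e]]] /asboolP[d' [h' [Gh' xh' e']]].
  have [c [_ Gv]] := hfracP v.
  apply/asboolP; exists ((d + d') + c)%N, (h * h' * v.2); split.
  + by apply: gr_M => //; apply: gr_M.
  + by rewrite !pt_notinM // hfrac_den.
  + have -> : h * h' * v.2 * (u.1 * w.2 - w.1 * u.2) =
      h * (u.1 * v.2 - v.1 * u.2) * (h' * w.2)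
      + h' * (v.1 * w.2 - w.1 * v.2) * (h * u.2) by ring.
    by rewrite e e' !mul0r addr0.
Qed.
Canonical hfrac_equivRel := EquivRelPack hfrac_equiv_is_equiv.

Definition local_ring : Type := {eq_quot hfrac_equiv}.
HB.instance Definition _ := Choice.on local_ring.
HB.instance Definition _ : EqQuotient _ hfrac_equiv local_ring :=
  EqQuotient.on local_ring.

Fact hfrac_add_subproof (u v : hfrac) :
  hfrac_axiom (u.1 * v.2 + v.1 * u.2, u.2 * v.2).
Proof.
have [[d [Gu Gu']] [e [Gv Gv']]] := (hfracP u, hfracP v).
rewrite /hfrac_axiom /= pt_notinM ?hfrac_den // andbT; apply/asboolP.
exists (d + e)%N; split; last exact: gr_M.
by apply: gr_add; [apply: gr_M | rewrite addnC; apply: gr_M].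
Qed.
Definition hfrac_add u v : hfrac := HFrac (hfrac_add_subproof u v).

Fact hfrac_mul_subproof (u v : hfrac) : hfrac_axiom (u.1 * v.1, u.2 * v.2).
Proof.
have [[d [Gu Gu']] [e [Gv Gv']]] := (hfracP u, hfracP v).
rewrite /hfrac_axiom /= pt_notinM ?hfrac_den // andbT; apply/asboolP.
by exists (d + e)%N; split; apply: gr_M.
Qed.
Definition hfrac_mul u v : hfrac := HFrac (hfrac_mul_subproof u v).

Fact hfrac_opp_subproof (u : hfrac) : hfrac_axiom (- u.1, u.2).
Proof.
have [d [Gu Gu']] := hfracP u.
rewrite /hfrac_axiom /= hfrac_den andbT; apply/asboolP.
by exists d; split=> //; apply: gr_opp.
Qed.
Definition hfrac_opp u : hfrac := HFrac (hfrac_opp_subproof u).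

Fact hfrac_scale_subproof (k : K) (u : hfrac) : hfrac_axiom (k *: u.1, u.2).
Proof.
have [d [Gu Gu']] := hfracP u.
rewrite /hfrac_axiom /= hfrac_den andbT; apply/asboolP.
by exists d; split=> //; apply: gr_scale.
Qed.
Definition hfrac_scale k u : hfrac := HFrac (hfrac_scale_subproof k u).

Fact hfrac_0_subproof : hfrac_axiom (0, 1).
Proof.
rewrite /hfrac_axiom /= pt_notin1 andbT; apply/asboolP; exists 0%N.
by split; [apply: gr_0 | apply: gr_1].
Qed.
Definition hfrac_0 : hfrac := HFrac hfrac_0_subproof.

Fact hfrac_1_subproof : hfrac_axiom (1, 1).
Proof.
rewrite /hfrac_axiom /= pt_notin1 andbT; apply/asboolP; exists 0%N.
by split; apply: gr_1.
Qed.
Definition hfrac_1 : hfrac := HFrac hfrac_1_subproof.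

Definition lr_pi (u : hfrac) : local_ring := \pi_local_ring u.

Lemma lr_piP u v : reflect (lr_pi u = lr_pi v) (hfrac_equiv u v).
Proof. exact: eqmodP. Qed.

Lemma lr_ind (P : local_ring -> Prop) : (forall u, P (lr_pi u)) -> forall z, P z.
Proof. by move=> H z; rewrite -[z]reprK; apply: H. Qed.

Lemma lr_repr u : hfrac_equiv (repr (lr_pi u)) u.
Proof. by apply/lr_piP; rewrite /lr_pi reprK. Qed.

Definition lr_add (y z : local_ring) := lr_pi (hfrac_add (repr y) (repr z)).
Definition lr_mul (y z : local_ring) := lr_pi (hfrac_mul (repr y) (repr z)).
Definition lr_opp (y : local_ring) := lr_pi (hfrac_opp (repr y)).
Definition lr_scale (k : K) (y : local_ring) := lr_pi (hfrac_scale k (repr y)).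

Lemma lr_addE u v : lr_add (lr_pi u) (lr_pi v) = lr_pi (hfrac_add u v).
Proof.
apply/lr_piP; have /asboolP[d [h [Gh xh e]]] := lr_repr u.
have /asboolP[d' [h' [Gh' xh' e']]] := lr_repr v.
apply/asboolP; exists (d + d')%N, (h * h').
split; [exact: gr_M|exact: pt_notinM|].
move: (repr (lr_pi u)) (repr (lr_pi v)) e e' => a b e e' /=.
transitivity (h * (a.1 * u.2 - u.1 * a.2) * (h' * b.2 * v.2)
  + h' * (b.1 * v.2 - v.1 * b.2) * (h * a.2 * u.2)); first by ring.
by rewrite e e' !mul0r addr0.
Qed.

Lemma lr_mulE u v : lr_mul (lr_pi u) (lr_pi v) = lr_pi (hfrac_mul u v).
Proof.
apply/lr_piP; have /asboolP[d [h [Gh xh e]]] := lr_repr u.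
have /asboolP[d' [h' [Gh' xh' e']]] := lr_repr v.
apply/asboolP; exists (d + d')%N, (h * h').
split; [exact: gr_M|exact: pt_notinM|].
move: (repr (lr_pi u)) (repr (lr_pi v)) e e' => a b e e' /=.
transitivity (h * (a.1 * u.2 - u.1 * a.2) * (h' * b.1 * v.2)
  + h' * (b.1 * v.2 - v.1 * b.2) * (h * u.1 * a.2)); first by ring.
by rewrite e e' !mul0r addr0.
Qed.

Lemma lr_oppE u : lr_opp (lr_pi u) = lr_pi (hfrac_opp u).
Proof.
apply/lr_piP; have /asboolP[d [h [Gh xh e]]] := lr_repr u.
apply/asboolP; exists d, h; split=> //=.
by rewrite !mulNr -opprD mulrN e oppr0.
Qed.

Lemma lr_scaleE k u : lr_scale k (lr_pi u) = lr_pi (hfrac_scale k u).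
Proof.
apply/lr_piP; have /asboolP[d [h [Gh xh e]]] := lr_repr u.
apply/asboolP; exists d, h; split=> //=.
by rewrite -!scalerAl -scalerBr -scalerAr e scaler0.
Qed.

Fact lr_addA : associative lr_add.
Proof.
elim/lr_ind=> u; elim/lr_ind=> v; elim/lr_ind=> w; rewrite !lr_addE.
by apply/lr_piP/hfrac_equivI => /=; ring.
Qed.
Fact lr_addC : commutative lr_add.
Proof.
elim/lr_ind=> u; elim/lr_ind=> v; rewrite !lr_addE.
by apply/lr_piP/hfrac_equivI => /=; ring.
Qed.
Fact lr_add0 : left_id (lr_pi hfrac_0) lr_add.
Proof.
elim/lr_ind=> u; rewrite !lr_addE.
by apply/lr_piP/hfrac_equivI => /=; ring.
Qed.
Fact lr_addN : left_inverse (lr_pi hfrac_0) lr_opp lr_add.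
Proof.
elim/lr_ind=> u; rewrite lr_oppE !lr_addE.
by apply/lr_piP/hfrac_equivI => /=; ring.
Qed.
HB.instance Definition _ :=
  GRing.isZmodule.Build local_ring lr_addA lr_addC lr_add0 lr_addN.

Fact lr_mulA : associative lr_mul.
Proof.
elim/lr_ind=> u; elim/lr_ind=> v; elim/lr_ind=> w; rewrite !lr_mulE.
by apply/lr_piP/hfrac_equivI => /=; ring.
Qed.
Fact lr_mulC : commutative lr_mul.
Proof.
elim/lr_ind=> u; elim/lr_ind=> v; rewrite !lr_mulE.
by apply/lr_piP/hfrac_equivI => /=; ring.
Qed.
Fact lr_mul1 : left_id (lr_pi hfrac_1) lr_mul.
Proof.
elim/lr_ind=> u; rewrite !lr_mulE.
by apply/lr_piP/hfrac_equivI => /=; ring.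
Qed.
Fact lr_mulDl : left_distributive lr_mul lr_add.
Proof.
elim/lr_ind=> u; elim/lr_ind=> v; elim/lr_ind=> w.
rewrite !(lr_mulE, lr_addE).
by apply/lr_piP/hfrac_equivI => /=; ring.
Qed.
Fact lr_1neq0 : lr_pi hfrac_1 != lr_pi hfrac_0.
Proof.
apply/eqP => /lr_piP/asboolP[d [h [_ /negP xh]]] /=.
by rewrite mulr1 mul0r subr0 mulr1 => h0; apply: xh; rewrite h0 rpred0.
Qed.
HB.instance Definition _ := GRing.Zmodule_isComNzRing.Build local_ring
  lr_mulA lr_mulC lr_mul1 lr_mulDl lr_1neq0.

Fact lr_scaleA k l z : lr_scale k (lr_scale l z) = lr_scale (k * l) z.
Proof.
elim/lr_ind: z => u; rewrite !lr_scaleE.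
by apply/lr_piP/hfrac_equivI => /=; rewrite scalerA.
Qed.
Fact lr_scale1 : left_id 1 lr_scale.
Proof.
elim/lr_ind=> u; rewrite !lr_scaleE.
by apply/lr_piP/hfrac_equivI => /=; rewrite scale1r.
Qed.
Fact lr_scaleDr : right_distributive lr_scale lr_add.
Proof.
move=> k; elim/lr_ind=> u; elim/lr_ind=> v; rewrite !(lr_scaleE, lr_addE).
by apply/lr_piP/hfrac_equivI => /=; rewrite -!scalerAl -scalerDr scalerAl.
Qed.
Fact lr_scaleDl z : {morph lr_scale^~ z : k l / k + l >-> lr_add k l}.
Proof.
move=> k l; elim/lr_ind: z => u; rewrite !(lr_scaleE, lr_addE).
apply/lr_piP/hfrac_equivI => /=.
by rewrite scalerDl -!mulrDl mulrA mulrAC.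
Qed.
HB.instance Definition _ := GRing.Zmodule_isLmodule.Build K local_ring
  lr_scaleA lr_scale1 lr_scaleDr lr_scaleDl.

Fact lr_scaleAl (k : K) (y z : local_ring) : k *: (y * z) = k *: y * z.
Proof.
elim/lr_ind: y => u; elim/lr_ind: z => v.
change (lr_scale k (lr_mul (lr_pi u) (lr_pi v)) =
  lr_mul (lr_scale k (lr_pi u)) (lr_pi v)).
rewrite !(lr_scaleE, lr_mulE).
by apply/lr_piP/hfrac_equivI => /=; rewrite -!scalerAl.
Qed.
HB.instance Definition _ :=
  GRing.Lmodule_isLalgebra.Build K local_ring lr_scaleAl.
HB.instance Definition _ := GRing.Lalgebra_isComAlgebra.Build K local_ring.

End LocalRing.

Definition alg_isomorphic (K : fieldType) (A B : comAlgType K) : Prop :=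
  exists f : {lrmorphism A -> B}, bijective f.

(* The quotient of the module M by the submodule generated by G. *)
Section PresentedModule.
Variables (A : comNzRingType) (M : lmodType A) (G : M -> Prop).

Definition span : {pred M} := fun v =>
  `[< exists s : seq (A * M),
        (forall c, c \in s -> G c.2) /\ v = \sum_(c <- s) c.1 *: c.2 >].

Fact span_submod_closed : submod_closed span.
Proof.
split; first by apply/asboolP; exists [::]; rewrite big_nil.
move=> a u v /asboolP[s [sG ->]] /asboolP[t [tG ->]]; apply/asboolP.
exists ([seq (a * c.1, c.2) | c <- s] ++ t); split.
  by move=> c; rewrite mem_cat => /orP[/mapP[b /sG ? ->] //|/tG].
rewrite big_cat big_map /= scaler_sumr; congr (_ + _).
by apply: eq_bigr => c _; rewrite scalerA.
Qed.
HB.instance Definition _ := GRing.isSubmodClosed.Build A M span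
  span_submod_closed.

Definition pres_mod : Type := {ideal_quot span}.
HB.instance Definition _ := GRing.Zmodule.on pres_mod.

Definition pres_pi (v : M) : pres_mod := \pi_({ideal_quot span}) v.

Lemma pres_piD u v : pres_pi (u + v) = pres_pi u + pres_pi v.
Proof. exact: (raddfD \pi_({ideal_quot span})). Qed.

Lemma pres_pi_eq u v : (pres_pi u == pres_pi v) = (u - v \in span).
Proof. by rewrite Quotient.idealrBE. Qed.

Lemma pres_ind (P : pres_mod -> Prop) : (forall v, P (pres_pi v)) -> forall z, P z.
Proof. by move=> H z; rewrite -[z]reprK; apply: H. Qed.

Definition pres_scale (a : A) (z : pres_mod) : pres_mod := pres_pi (a *: repr z).

Lemma pres_scaleE a v : pres_scale a (pres_pi v) = pres_pi (a *: v).
Proof.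
apply/eqP; rewrite pres_pi_eq -scalerBr rpredZ // -pres_pi_eq.
by apply/eqP; rewrite /pres_pi reprK.
Qed.

Fact pres_scaleA a b z : pres_scale a (pres_scale b z) = pres_scale (a * b) z.
Proof. by elim/pres_ind: z => v; rewrite !pres_scaleE scalerA. Qed.
Fact pres_scale1 : left_id 1 pres_scale.
Proof. by elim/pres_ind=> v; rewrite pres_scaleE scale1r. Qed.
Fact pres_scaleDr : right_distributive pres_scale +%R.
Proof.
move=> a; elim/pres_ind=> u; elim/pres_ind=> v.
by rewrite -pres_piD !pres_scaleE -pres_piD scalerDr.
Qed.
Fact pres_scaleDl z : {morph pres_scale^~ z : a b / a + b}.
Proof.
by move=> a b; elim/pres_ind: z => v; rewrite !pres_scaleE -pres_piD scalerDl.
Qed.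
HB.instance Definition _ := GRing.Zmodule_isLmodule.Build A pres_mod
  pres_scaleA pres_scale1 pres_scaleDr pres_scaleDl.

End PresentedModule.

Section Kaehler.
Variables (K : fieldType) (A : comAlgType K).

Inductive kaehler_rel : {freeg A / A} -> Prop :=
| kaehler_add a b : kaehler_rel (<< a + b >> - << a >> - << b >>)
| kaehler_leibniz a b :
    kaehler_rel (<< a * b >> - a *: << b >> - b *: << a >>)
| kaehler_const (k : K) : kaehler_rel << k%:A >>.

Definition kaehler : lmodType A := pres_mod kaehler_rel.

Definition kdiff (a : A) : kaehler := pres_pi kaehler_rel << a >>.

End Kaehler.

Section ExteriorPower.
Variables (A : comNzRingType) (M : lmodType A) (m : nat).

Definition upd (t : {ffun 'I_m -> M}) (i : 'I_m) (u : M) : {ffun 'I_m -> M} :=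
  [ffun j => if j == i then u else t j].

Inductive ext_rel : {freeg {ffun 'I_m -> M} / A} -> Prop :=
| ext_linear (t : {ffun 'I_m -> M}) i (a : A) (u v : M) :
    ext_rel (<< upd t i (a *: u + v) >> - a *: << upd t i u >> - << upd t i v >>)
| ext_alternating (t : {ffun 'I_m -> M}) i j : i != j -> t i = t j -> ext_rel << t >>.

Definition ext_power : lmodType A := pres_mod ext_rel.

Definition wedge (t : {ffun 'I_m -> M}) : ext_power := pres_pi ext_rel << t >>.

End ExteriorPower.

Section GradedModules.
Variables (K : fieldType) (A : comAlgType K) (G : grading A).

Definition add_span (M : zmodType) (S : M -> Prop) (v : M) : Prop :=
  exists s : seq M, (forall w, w \in s -> S w) /\ v = \sum_(w <- s) w.

(* d : A -> Omega^1 is homogeneous of degree 0, so deg (d x_i) = 1. *)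
Definition kaehler_gr (e : nat) : kaehler A -> Prop :=
  add_span (fun w => exists i j a b,
    [/\ (i + j)%N = e, G i a, G j b & w = a *: kdiff b]).

Definition ext_gr (M : lmodType A) (grM : nat -> M -> Prop) (m e : nat) :
  ext_power M m -> Prop :=
  add_span (fun w => exists i (c : 'I_m -> nat) a (t : {ffun 'I_m -> M}),
    [/\ (i + \sum_j c j)%N = e, G i a, forall j, grM (c j) (t j)
      & w = a *: wedge t]).

(* V is a K-subspace of dimension d of the A-module M, where K acts on M
   through K -> A. *)
Definition dim_eq (M : lmodType A) (V : M -> Prop) (d : nat) : Prop :=
  exists b : 'I_d -> M,
    (forall c : 'I_d -> K, \sum_i (c i)%:A *: b i = 0 -> forall i, c i = 0) /\
    (forall v, V v <-> exists c : 'I_d -> K, v = \sum_i (c i)%:A *: b i).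

Definition is_hilbert_poly (M : lmodType A) (grM : nat -> M -> Prop)
  (H : {poly rat}) : Prop :=
  exists N, forall e, (N <= e)%N ->
    exists2 d : nat, dim_eq (grM e) d & H.[e%:R] = d%:R.

End GradedModules.

Arguments kaehler {K} A.
Arguments ext_power {A} M m.

Section QuotientGrading.
Variables (K : fieldType) (A : comAlgType K) (G : grading A) (I : idealr A).
Hypothesis hI : homogeneous_ideal G I.

Definition quot_piece (d : nat) (x : quot_alg I) : Prop :=
  exists2 a, G d a & x = quot_pi I a.

Lemma quot_piece_lift (f : nat -> quot_alg I) : (forall i, quot_piece i (f i)) ->
  exists2 g : nat -> A, (forall i, G i (g i)) & forall i, f i = quot_pi I (g i).
Proof.
move=> fP; have /choice[g gP] i : exists a, G i a /\ f i = quot_pi I a.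
  by have [a] := fP i; exists a.
by exists g => i; have [] := gP i.
Qed.

Fact quot_piece_lin d (k : K) x y :
  quot_piece d x -> quot_piece d y -> quot_piece d (k *: x + y).
Proof.
move=> [a Ga ->] [b Gb ->]; exists (k *: a + b); first exact: gr_lin.
by rewrite quot_piD quot_piZ.
Qed.
Fact quot_piece0 d : quot_piece d 0.
Proof.
by exists 0; [exact: gr_0 | apply/esym/eqP; rewrite quot_pi_eq0 rpred0].
Qed.
Fact quot_piece1 : quot_piece 0%N 1.
Proof. by exists 1; [exact: gr_1 | rewrite quot_pi1]. Qed.
Fact quot_pieceM d e x y :
  quot_piece d x -> quot_piece e y -> quot_piece (d + e)%N (x * y).
Proof.
move=> [a Ga ->] [b Gb ->]; exists (a * b); first exact: gr_M.
by rewrite quot_piM.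
Qed.
Fact quot_piece_decomp x : exists N (f : nat -> quot_alg I),
  (forall i, quot_piece i (f i)) /\ x = \sum_(i < N) f i.
Proof.
have [a ->] := quot_pi_surj x; have [N [f [Gf ->]]] := gr_decomp G a.
exists N, (fun i => quot_pi I (f i)); split; first by move=> i; exists (f i).
exact: quot_pi_sum.
Qed.
Fact quot_piece_direct N (f : nat -> quot_alg I) :
  (forall i, quot_piece i (f i)) -> \sum_(i < N) f i = 0 ->
  forall i, (i < N)%N -> f i = 0.
Proof.
move=> /quot_piece_lift[g Gg fg] f0 i iN; apply/eqP; rewrite fg quot_pi_eq0.
apply: (hI (N := N)) => //; rewrite -quot_pi_eq0 quot_pi_sum; apply/eqP.
by rewrite -[RHS]f0; apply: eq_bigr => j _; rewrite fg.
Qed.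

Definition quot_grading : grading (quot_alg I) :=
  Grading quot_piece_lin quot_piece0 quot_piece1 quot_pieceM
    quot_piece_decomp quot_piece_direct.

End QuotientGrading.

Section PolynomialGrading.
Variables (K : fieldType) (n : nat).

Definition mpoly_piece (d : nat) (f : {mpoly K[n]}) : Prop := f \is d.-homog.

Fact mpoly_piece_lin d (k : K) (f g : {mpoly K[n]}) :
  mpoly_piece d f -> mpoly_piece d g -> mpoly_piece d (k *: f + g).
Proof. by move=> hf hg; apply: rpredD => //; apply: rpredZ. Qed.
Fact mpoly_piece0 d : mpoly_piece d 0.
Proof. exact: rpred0. Qed.
Fact mpoly_piece1 : mpoly_piece 0%N 1.
Proof. exact: dhomog1. Qed.
Fact mpoly_pieceM d e (f g : {mpoly K[n]}) :
  mpoly_piece d f -> mpoly_piece e g -> mpoly_piece (d + e)%N (f * g).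
Proof. exact: dhomogM. Qed.
Fact mpoly_piece_decomp (f : {mpoly K[n]}) :
  exists N (g : nat -> {mpoly K[n]}),
    (forall i, mpoly_piece i (g i)) /\ f = \sum_(i < N) g i.
Proof.
exists (msize f), (fun i => pihomog mdeg i f); split.
  by move=> i; apply: pihomogP.
exact: (@pihomog_partitionE _ _ mdeg).
Qed.
Fact mpoly_piece_direct N (g : nat -> {mpoly K[n]}) :
  (forall i, mpoly_piece i (g i)) -> \sum_(i < N) g i = 0 ->
  forall i, (i < N)%N -> g i = 0.
Proof.
move=> hg g0 i iN; have := congr1 (pihomog mdeg i) g0.
rewrite raddf_sum raddf0 /= (bigD1 (Ordinal iN)) //= (pihomog_dE (hg i)).
rewrite big1 ?addr0 // => j ji; apply: (pihomog_ne0 _ (hg j)).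
by apply: contraNneq ji => ji; apply/eqP/val_inj.
Qed.

Definition mpoly_grading : grading {mpoly K[n]} :=
  Grading mpoly_piece_lin mpoly_piece0 mpoly_piece1 mpoly_pieceM
    mpoly_piece_decomp mpoly_piece_direct.

(* I = I : (X_0, ..., X_{n-1})^oo; the N-th power of this ideal is generated by
   the forms of degree N. *)
Definition saturated (I : {pred {mpoly K[n]}}) : Prop :=
  forall (f : {mpoly K[n]}) N,
    (forall g : {mpoly K[n]}, g \is N.-homog -> g * f \in I) -> f \in I.

Definition generated_by_powers (k : 'I_n -> nat) (Q : {pred {mpoly K[n]}}) :
  Prop :=
  forall f, f \in Q <->
    exists c : 'I_n -> {mpoly K[n]}, f = \sum_i c i * 'X_i ^+ k i.

End PolynomialGrading.

Definition support_enum (K : fieldType) (A : comAlgType K) (G : grading A)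
  (s : nat) (pt : 'I_s -> proj_point G) : Prop :=
  [/\ forall j, closed_point (pt j),
      forall i j, (pt i : {pred A}) =i (pt j : {pred A}) -> i = j
    & forall x : proj_point G, closed_point x ->
        exists j, (x : {pred A}) =i (pt j : {pred A})].

(* An ideal generated by pure powers of all the indeterminates is a monomial
   complete intersection, hence automatically Gorenstein. *)
Definition locally_monomial_gorenstein (K : fieldType) (A : comAlgType K)
  (G : grading A) (n s : nat) (pt : 'I_s -> proj_point G)
  (k : 'I_n -> 'I_s -> nat) : Prop :=
  forall j, exists Q : idealr {mpoly K[n]},
    generated_by_powers (k^~ j) Q /\
    alg_isomorphic (local_ring (pt j)) (quot_alg Q).

Definition Gamma_set (p n s : nat) (k : 'I_n -> 'I_s -> nat) (S : {set 'I_n})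
  (j : 'I_s) : {set 'I_n} := [set i in S | ~~ (p %| k i j)%N].

(* Main.v *)
(* Let A = P / I, with charts phi_j : A -> O_j = K[X] / Q_j dividing a form of
   degree d by the d-th power of a linear form that does not vanish at p_j.
   Saturation makes the phi_j jointly injective in every degree, and the Chinese
   remainder theorem makes them jointly surjective in large degrees, so for
   large N there are forms eps_j and y_ij of degree N with values 1 and X_i at
   p_j, and 0 at the other points.  Where eps_j is invertible, Omega^1 is
   generated by d eps_j and the d y_ij, subject to k_ij y_ij^(k_ij - 1) d y_ij = 0.
   Hence in large degrees Omega^m is spanned by the products of a form with
   values X^alpha at p_j, 0 elsewhere, by a wedge of m of these differentials,
   where alpha_i < k_ij, and alpha_i < k_ij - 1 when d y_ij occurs and k_ij is
   nonzero in K.  These elements are independent: the derivations d/dX_i and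
   (1/N) E - \sum_i X_i d/dX_i, with E the Euler derivation of A and N nonzero
   in K, are dual to them, and their m x m determinants with values in
   K[X] / (X_i^(alpha_i + 1)) give the dual linear forms.  The wedges that
   contain d eps_j are those of the first inner sum of the formula. *)

Require Import Defs.
From HB Require Import structures.
From mathcomp Require Import all_boot all_algebra all_field.
From mathcomp Require Import boolp.
From mathcomp Require classical_sets.
From mathcomp Require Import freeg mpoly.
From mathcomp Require Import perm ring.

Set Implicit Arguments.
Unset Strict Implicit.
Unset Printing Implicit Defensive.

Import GRing.Theory.
Local Open Scope ring_scope.
Local Open Scope quotient_scope.

(** Its invertibility in K serves twice. It normalizes the Euler derivation on eps_j. It also
    handles degrees outside the multiples of N: a form tau of degree N + 1 with value 1 satisfies
    tau^N = eps_j^(N+1), which determines d tau once N and eps_j can be divided out. Only then are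
    the differentials of the linear generators of A under control. No module is localized: working
    where eps_j is invertible means multiplying by a power of eps_j of known degree. In large
    degrees this costs nothing, since a form supported at p_j is determined by its degree and its
    value, and eps_j has value 1, so such a form is divisible by any fixed power of eps_j. If k_ij
    is nonzero in K, d/dX_i does not descend to O_j. It does become a derivation from O_j into the
    quotient by the X_i^(alpha_i + 1) when alpha_i < k_ij - 1, which is why the functionals are
    built for one monomial at a time. *)

(** * Universal property of modules given by generators and relations *)

Section SemilinearLift.
Variables (A C : comNzRingType) (phi : {rmorphism A -> C}).

(* [C] as an [A]-module through [phi]. *)
Definition restr_along of {rmorphism A -> C} : Type := C.
Notation restr_scalars := (restr_along phi).
HB.instance Definition _ := GRing.Zmodule.on restr_scalars.

Definition restr_scale (a : A) (c : restr_scalars) : restr_scalars :=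
  (phi a * (c : C))%R.

Fact restr_scaleA a b c :
  restr_scale a (restr_scale b c) = restr_scale (a * b) c.
Proof. by rewrite /restr_scale rmorphM mulrA. Qed.
Fact restr_scale1 : left_id 1 restr_scale.
Proof. by move=> c; rewrite /restr_scale rmorph1 mul1r. Qed.
Fact restr_scaleDr : right_distributive restr_scale +%R.
Proof. by move=> a c d; rewrite /restr_scale mulrDr. Qed.
Fact restr_scaleDl c : {morph restr_scale^~ c : a b / a + b}.
Proof. by move=> a b; rewrite /restr_scale rmorphD mulrDl. Qed.
HB.instance Definition _ := GRing.Zmodule_isLmodule.Build A restr_scalars
  restr_scaleA restr_scale1 restr_scaleDr restr_scaleDl.

(** The target stays a ring on which [A] acts through [phi], so that products and determinants of
    values make sense. *)
Definition semilinear (M : lmodType A) (f : M -> C) : Prop :=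
  {morph f : u v / u + v} /\ forall a u, f (a *: u) = phi a * f u.

Lemma semilinear0 (M : lmodType A) (f : M -> C) : semilinear f -> f 0 = 0.
Proof. by case=> _ fZ; rewrite -[0](scale0r 0) fZ rmorph0 mul0r. Qed.

Lemma semilinearN (M : lmodType A) (f : M -> C) : semilinear f ->
  {morph f : u / - u}.
Proof. by case=> _ fZ u; rewrite -scaleN1r fZ rmorphN rmorph1 mulN1r. Qed.

Lemma semilinear_sum (M : lmodType A) (f : M -> C) (I : Type) (r : seq I)
    (P : pred I) (F : I -> M) : semilinear f ->
  f (\sum_(i <- r | P i) F i) = \sum_(i <- r | P i) f (F i).
Proof. by move=> fL; apply: big_morph; [case: fL | apply: semilinear0]. Qed.

Variables (X : choiceType) (f : X -> C).

Definition free_lift (D : {freeg X / A}) : C :=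
  fglift (f : X -> restr_scalars) D.

Lemma free_liftU a x : free_lift << a *g x >> = phi a * f x.
Proof. exact: (@liftU A restr_scalars X f). Qed.

Fact free_lift_is_zmod_morphism : zmod_morphism free_lift.
Proof. exact: (@lift_is_additive A X restr_scalars f). Qed.
HB.instance Definition _ :=
  GRing.isZmodMorphism.Build {freeg X / A} C free_lift free_lift_is_zmod_morphism.

Lemma free_lift_semilinear : semilinear free_lift.
Proof.
split=> [|a D]; first exact: raddfD.
rewrite -[D in LHS]freeg_sumE -[D in RHS]freeg_sumE scaler_sumr !raddf_sum mulr_sumr.
apply: eq_bigr => x _ /=.
suff -> : a *: << coeff x D *g x >> = << a * coeff x D *g x >> :> {freeg X / A}.
  by rewrite !free_liftU rmorphM mulrA.
by apply/eqP/freeg_eqP => y; rewrite coeffZ !coeffU mulrA.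
Qed.

(** Universal property of generators and relations; the maps out of Omega^1 and out of its exterior
    powers are both obtained from it. *)
Lemma pres_lift (G : {freeg X / A} -> Prop) :
  (forall D, G D -> free_lift D = 0) ->
  exists2 g : pres_mod G -> C, semilinear g &
    forall x, g (pres_pi G << x >>) = f x.
Proof.
move=> G0; have [fD fZ] := free_lift_semilinear.
have fN := semilinearN free_lift_semilinear.
have span0 D : D \in Defs.span G -> free_lift D = 0.
  move=> /asboolP[s [sG ->]]; rewrite (semilinear_sum _ _ _ free_lift_semilinear).
  by rewrite big_seq big1 // => c /sG/G0 c0; rewrite fZ c0 mulr0.
pose g (z : pres_mod G) := free_lift (repr z).
have gE D : g (pres_pi G D) = free_lift D.
  apply/eqP; rewrite -subr_eq0 -fN -fD; apply/eqP/span0.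
  by rewrite -pres_pi_eq /pres_pi reprK.
exists g; last by move=> x; rewrite gE free_liftU rmorph1 mul1r.
split.
  by elim/pres_ind=> u; elim/pres_ind=> v; rewrite -pres_piD !gE.
move=> a; elim/pres_ind=> u.
by rewrite -[a *: _]/(pres_scale a _) pres_scaleE !gE fZ.
Qed.

End SemilinearLift.

Lemma span_gen (A : comNzRingType) (M : lmodType A) (G : M -> Prop) v :
  G v -> v \in Defs.span G.
Proof.
move=> Gv; apply/asboolP; exists [:: (1, v)].
by split; [move=> c; rewrite inE => /eqP-> | rewrite big_seq1 scale1r].
Qed.

Lemma pres_piB (A : comNzRingType) (M : lmodType A) (G : M -> Prop) u v :
  pres_pi G (u - v) = pres_pi G u - pres_pi G v.
Proof. exact: (raddfB \pi_({ideal_quot Defs.span G})). Qed.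

Lemma pres_piZ (A : comNzRingType) (M : lmodType A) (G : M -> Prop) a v :
  pres_pi G (a *: v) = a *: pres_pi G v.
Proof. by rewrite -pres_scaleE. Qed.

Lemma pres_pi0 (A : comNzRingType) (M : lmodType A) (G : M -> Prop) v :
  G v -> pres_pi G v = 0.
Proof.
move=> Gv; have -> : 0 = pres_pi G 0 by rewrite -(scale0r (0 : M)) pres_piZ scale0r.
by apply/eqP; rewrite pres_pi_eq subr0 span_gen.
Qed.

(** * Kähler differentials and derivations *)

Section Derivations.
Variables (K : fieldType) (A : comAlgType K).

Lemma kdiffD : {morph kdiff (A := A) : a b / a + b}.
Proof.
move=> a b; apply/eqP; rewrite -subr_eq0 opprD addrA -!pres_piB.
by rewrite pres_pi0 //; apply: kaehler_add.
Qed.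

Lemma kdiffM a b : kdiff (a * b : A) = a *: kdiff b + b *: kdiff a.
Proof.
apply/eqP; rewrite -subr_eq0 opprD addrA -!pres_piZ -!pres_piB.
by rewrite pres_pi0 //; apply: kaehler_leibniz.
Qed.

Lemma kdiffC (k : K) : kdiff (k%:A : A) = 0.
Proof. by rewrite /kdiff pres_pi0 //; apply: kaehler_const. Qed.

Lemma kdiff0 : kdiff (0 : A) = 0.
Proof. by rewrite -(scale0r 1) kdiffC. Qed.

Lemma kdiffZ (k : K) (a : A) : kdiff (k *: a) = k%:A *: kdiff a.
Proof. by rewrite -[k *: a]mul1r -scalerAr scalerAl kdiffM kdiffC scaler0 addr0. Qed.

Lemma kdiffX (a : A) d : kdiff (a ^+ d.+1) = d.+1%:R%:A *: (a ^+ d *: kdiff a).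
Proof.
elim: d => [|d IH]; first by rewrite expr1 expr0 !scale1r.
rewrite exprS kdiffM IH 2!scalerA [a ^+ d.+1]exprS -scalerDl scalerA.
by congr (_ *: _); rewrite -[d.+2%:R]natr1 scalerDl scale1r; ring.
Qed.

Definition derivation_along (C : comNzRingType) (phi D : A -> C) : Prop :=
  [/\ {morph D : a b / a + b}, forall a b, D (a * b) = phi a * D b + phi b * D a
    & forall k : K, D k%:A = 0].

Lemma kaehler_lift (C : comNzRingType) (phi : {rmorphism A -> C}) (D : A -> C) :
  derivation_along phi D ->
  exists2 th : kaehler A -> C, semilinear phi th & forall a, th (kdiff a) = D a.
Proof.
move=> [DD DM DC]; apply: pres_lift => u.
have L := free_lift_semilinear phi D; have [LD LZ] := L; have LN := semilinearN L.
case=> [a b|a b|k].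
- by rewrite !LD !LN !free_liftU rmorph1 !mul1r DD; ring.
- by rewrite !LD !LN !LZ !free_liftU rmorph1 !mul1r DM; ring.
- by rewrite free_liftU DC mulr0.
Qed.

End Derivations.

(** * Exterior powers and determinants *)

Section Wedge.
Variables (A : comNzRingType) (M : lmodType A) (m : nat).
Implicit Type t : {ffun 'I_m -> M}.

Lemma wedge_lin t i (a : A) u v :
  wedge (upd t i (a *: u + v)) = a *: wedge (upd t i u) + wedge (upd t i v).
Proof.
apply/eqP; rewrite -subr_eq0 opprD addrA -!pres_piZ -!pres_piB.
by rewrite pres_pi0 //; apply: ext_linear.
Qed.

Lemma wedge_alt t i j : i != j -> t i = t j -> wedge t = 0.
Proof. by move=> ij tij; rewrite /wedge pres_pi0 //; apply: ext_alternating ij tij. Qed.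

Lemma wedge_updD t i u v :
  wedge (upd t i (u + v)) = wedge (upd t i u) + wedge (upd t i v).
Proof. by rewrite -[u]scale1r wedge_lin !scale1r. Qed.

Lemma wedge_upd0 t i : wedge (upd t i 0) = 0.
Proof.
have := wedge_updD t i 0 0; rewrite addr0 -[X in X = _]addr0.
by move/addrI/esym.
Qed.

Lemma wedge_updZ t i a u : wedge (upd t i (a *: u)) = a *: wedge (upd t i u).
Proof. by rewrite -[a *: u]addr0 wedge_lin wedge_upd0 addr0. Qed.

Lemma wedge_upd_sum t i (I : Type) (r : seq I) (P : pred I) (F : I -> M) :
  wedge (upd t i (\sum_(l <- r | P l) F l)) = \sum_(l <- r | P l) wedge (upd t i (F l)).
Proof.
by apply: (big_morph (fun u => wedge (upd t i u))) => [u v|];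
  [apply: wedge_updD | apply: wedge_upd0].
Qed.

Lemma upd_id t i : upd t i (t i) = t.
Proof. by apply/ffunP=> j; rewrite ffunE; case: eqP => [->|]. Qed.

Lemma wedge_tperm t i j : i != j ->
  wedge [ffun l => t (tperm i j l)] = - wedge t.
Proof.
move=> ij; pose w u v := wedge (upd (upd t i u) j v).
have wDl u u' v : w (u + u') v = w u v + w u' v.
  have E x : upd (upd t i x) j v = upd (upd t j v) i x.
    apply/ffunP=> l; rewrite !ffunE; case: (l =P j) => [->|//].
    by rewrite eq_sym (negPf ij).
  by rewrite /w !E wedge_updD.
have w0 u : w u u = 0.
  by apply: (wedge_alt ij); rewrite !ffunE eqxx (negPf ij) eqxx.
have wDr u v v' : w u (v + v') = w u v + w u v' by apply: wedge_updD.
have := w0 (t i + t j); rewrite wDl !wDr !w0 addr0 add0r => /eqP.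
rewrite addr_eq0 => /eqP wE.
have <- : w (t i) (t j) = wedge t.
  rewrite /w; congr wedge; apply/ffunP=> l; rewrite !ffunE.
  by case: (l =P j) => [->|_] //; case: (l =P i) => [->|].
rewrite wE opprK; congr wedge; apply/ffunP=> l; rewrite !ffunE.
case: (l =P j) => [->|/eqP lj]; first by rewrite tpermR.
case: (l =P i) => [->|/eqP li]; first by rewrite tpermL.
by rewrite tpermD // eq_sym.
Qed.

Lemma wedge_perm t (s : 'S_m) :
  wedge [ffun l => t (s l)] = (-1) ^+ s *: wedge t.
Proof.
have [ts -> _] := prod_tpermP s; elim: ts t => [|[i j] ts IH] t.
  rewrite big_nil odd_perm1 scale1r; congr wedge.
  by apply/ffunP=> l; rewrite ffunE perm1.
rewrite big_cons /=.
have -> : [ffun l => t ((tperm i j * \prod_(x <- ts) tperm x.1 x.2)%g l)] =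
          [ffun l => [ffun l => t ((\prod_(x <- ts) tperm x.1 x.2)%g l)] (tperm i j l)].
  by apply/ffunP=> l; rewrite !ffunE permM.
have [->|ij] := eqVneq i j.
  rewrite tperm1 mul1g -IH; congr wedge; apply/ffunP=> l.
  by rewrite !ffunE perm1.
rewrite wedge_tperm // IH odd_mul_tperm ij addTb.
by rewrite signrN scaleNr.
Qed.

(** A determinant is multilinear and alternating in its columns, so it respects the relations of the
    exterior power; the transposes appear because the determinant lemmas used speak of rows. Applied
    to maps induced by m derivations, it gives the maps that detect wedges of differentials. *)
Lemma wedge_lift_det (C : comNzRingType) (phi : {rmorphism A -> C})
    (th : 'I_m -> M -> C) : (forall i, semilinear phi (th i)) ->
  exists2 g : ext_power M m -> C, semilinear phi g &
    forall t, g (wedge t) = \det (\matrix_(i, j) th i (t j)).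
Proof.
move=> thL; pose f t := \det (\matrix_(i, j) th i (t j)).
suff [g gL gE] : exists2 g : ext_power M m -> C, semilinear phi g &
    forall t, g (wedge t) = f t by exists g.
apply: pres_lift => u; have L := free_lift_semilinear phi f.
have [LD LZ] := L; have LN := semilinearN L.
case=> [t i a v w|t i j ij tij].
- rewrite !LD !LN LZ !free_liftU rmorph1 !mul1r /f.
  pose T x := (\matrix_(r, l) th r (upd t i x l))^T.
  have -> : \det (\matrix_(r, l) th r (upd t i (a *: v + w) l)) =
            phi a * \det (T v) + 1 * \det (T w); last by rewrite !det_tr; ring.
  rewrite -det_tr; apply: (@determinant_multilinear _ _ _ _ _ i).
  + by apply/rowP=> l; rewrite !mxE !ffunE eqxx mul1r; case: (thL l) => -> ->.
  + by apply/matrixP=> r l; rewrite !mxE !ffunE eq_sym (negPf (neq_lift _ _)).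
  + by apply/matrixP=> r l; rewrite !mxE !ffunE eq_sym (negPf (neq_lift _ _)).
- rewrite free_liftU /f -det_tr (determinant_alternate ij) ?mulr0 // => l.
  by rewrite !mxE tij.
Qed.

End Wedge.

(** * Morphisms and derivations on quotient algebras *)

Section QuotientMorphisms.
Variables (K : fieldType) (A : comAlgType K) (I : idealr A).

Fact quot_pi_is_zmod_morphism : zmod_morphism (quot_pi I).
Proof. exact: (raddfB \pi_({ideal_quot I})). Qed.
Fact quot_pi_is_monoid_morphism : monoid_morphism (quot_pi I).
Proof. by split; [apply: quot_pi1 | apply: quot_piM]. Qed.
HB.instance Definition _ := GRing.isZmodMorphism.Build A (quot_alg I)
  (quot_pi I) quot_pi_is_zmod_morphism.
HB.instance Definition _ := GRing.isMonoidMorphism.Build A (quot_alg I)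
  (quot_pi I) quot_pi_is_monoid_morphism.
HB.instance Definition _ := GRing.isScalable.Build K A (quot_alg I) *:%R
  (quot_pi I) (quot_piZ I).

Lemma quot_pi_eq a b : (quot_pi I a == quot_pi I b) = (a - b \in I).
Proof. by rewrite -quot_pi_eq0 raddfB subr_eq0. Qed.

Lemma quot_repr a : repr (quot_pi I a) - a \in I.
Proof. by rewrite -quot_pi_eq /quot_pi reprK. Qed.

Lemma quot_lift (C : comAlgType K) (g : {lrmorphism A -> C}) :
  (forall a, a \in I -> g a = 0) ->
  exists h : {lrmorphism quot_alg I -> C}, forall a, h (quot_pi I a) = g a.
Proof.
move=> g0; pose h0 (x : quot_alg I) := g (repr x).
have hE a : h0 (quot_pi I a) = g a.
  by apply/eqP; rewrite -subr_eq0 -raddfB; apply/eqP/g0/quot_repr.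
have hB : zmod_morphism h0.
  move=> x y; have [a ->] := quot_pi_surj x; have [b ->] := quot_pi_surj y.
  by rewrite -raddfB !hE raddfB.
have hM : monoid_morphism h0.
  split; first by rewrite -(quot_pi1 I) hE rmorph1.
  move=> x y; have [a ->] := quot_pi_surj x; have [b ->] := quot_pi_surj y.
  by rewrite -rmorphM !hE rmorphM.
have hZ : scalable h0.
  by move=> c x; have [a ->] := quot_pi_surj x; rewrite -linearZ !hE linearZ.
pose h : {lrmorphism quot_alg I -> C} := HB.pack h0
  (GRing.isZmodMorphism.Build _ _ h0 hB) (GRing.isMonoidMorphism.Build _ _ h0 hM)
  (GRing.isScalable.Build _ _ _ _ h0 hZ).
by exists h.
Qed.

Lemma quot_derivation (C : comNzRingType) (g D : A -> C) (h : quot_alg I -> C) :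
  derivation_along g D -> (forall a, a \in I -> D a = 0) ->
  (forall a, h (quot_pi I a) = g a) ->
  exists2 E : quot_alg I -> C, derivation_along h E &
    forall a, E (quot_pi I a) = D a.
Proof.
move=> [DD DM DC] D0 hE; pose E (x : quot_alg I) := D (repr x).
have EE a : E (quot_pi I a) = D a.
  by rewrite /E -[repr _](subrK a) DD D0 ?add0r // quot_repr.
exists E => //; split=> [x y|x y|k].
- have [a ->] := quot_pi_surj x; have [b ->] := quot_pi_surj y.
  by rewrite -raddfD !EE.
- have [a ->] := quot_pi_surj x; have [b ->] := quot_pi_surj y.
  by rewrite -rmorphM !EE DM !hE.
- by rewrite -(quot_pi1 I) -linearZ EE.
Qed.

Lemma derivation_quot_pi (D : A -> A) : derivation_along id D ->
  derivation_along (quot_pi I) (fun a => quot_pi I (D a)).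
Proof.
move=> [DD DM DC]; split=> [a b|a b|k]; first by rewrite DD quot_piD.
  by rewrite DM quot_piD !quot_piM.
by rewrite DC raddf0.
Qed.

End QuotientMorphisms.

Lemma quot_factor (K : fieldType) (A : comAlgType K) (I J : idealr A) :
  {subset I <= J} -> exists h : {lrmorphism quot_alg I -> quot_alg J},
    forall a, h (quot_pi I a) = quot_pi J a.
Proof.
move=> IJ; pose g : {lrmorphism A -> quot_alg J} := quot_pi J.
by apply: (@quot_lift _ _ I _ g) => a /IJ aJ; apply/eqP; rewrite quot_pi_eq0.
Qed.

(** * Nilpotent elements and quotients by pure powers of the variables *)

Definition nilp (B : comNzRingType) (x : B) : Prop := exists d, x ^+ d = 0.

Lemma nilpD (B : comNzRingType) (x y : B) : nilp x -> nilp y -> nilp (x + y).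
Proof.
move=> [d xd] [e ye]; exists (d + e)%N; rewrite exprDn big1 // => i _.
have [dle|ltd] := leqP e i.
  by rewrite -(subnK dle) exprD ye mulr0 mulr0 mul0rn.
have {ltd} le : (d <= d + e - i)%N by rewrite -addnBA ?leq_addr // ltnW.
by rewrite -(subnK le) exprD xd mulr0 mul0r mul0rn.
Qed.

Lemma nilpM (B : comNzRingType) (x y : B) : nilp x -> nilp (y * x).
Proof. by move=> [d xd]; exists d; rewrite exprMn xd mulr0. Qed.

Section MonomialIdeals.
Variables (K : fieldType) (n : nat).
Local Notation P := {mpoly K[n]}.

(* The ideal generated by the [X_i ^ (alpha_i + 1)]: its quotient has socle
   spanned by [X ^ alpha]. *)
Definition low_ideal (alpha : 'X_{1..n}) : {pred P} :=
  fun f => `[< forall beta, (beta <= alpha)%MM -> f@_beta = 0 >].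

Lemma low_idealP alpha f :
  reflect (forall beta, (beta <= alpha)%MM -> f@_beta = 0) (f \in low_ideal alpha).
Proof. exact: asboolP. Qed.

Fact low_ideal_idealr alpha : idealr_closed (low_ideal alpha).
Proof.
split.
- by apply/low_idealP => beta _; rewrite mcoeff0.
- apply/low_idealP => /(_ 0%MM); rewrite mcoeff1 eqxx => H.
  have /H/eqP : (0 <= alpha)%MM by apply/mnm_lepP => i; rewrite mnm0E.
  by rewrite oner_eq0.
move=> a u v /low_idealP u0 /low_idealP v0; apply/low_idealP => beta le.
rewrite mcoeffD v0 // addr0 mcoeffM big1 // => k /eqP E; rewrite u0 ?mulr0 //.
by apply: lepm_trans le; have := lem_addl k.1 k.2; rewrite -E.
Qed.
HB.instance Definition _ alpha :=
  isIdealr.Build P (low_ideal alpha) (low_ideal_idealr alpha).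

(** Coefficient of the socle monomial X^alpha; it is independent of the representative, since
    members of the ideal have no such term. *)
Definition low_coef alpha (x : quot_alg (low_ideal alpha)) : K :=
  (repr x)@_alpha.

Lemma low_coefE alpha f : low_coef (quot_pi (low_ideal alpha) f) = f@_alpha.
Proof.
apply/eqP; rewrite -subr_eq0 -mcoeffB; apply/eqP.
by have /low_idealP := quot_repr (low_ideal alpha) f; apply; apply: lepm_refl.
Qed.

Lemma low_coefD alpha : {morph @low_coef alpha : x y / x + y}.
Proof.
move=> x y; have [a ->] := quot_pi_surj x; have [b ->] := quot_pi_surj y.
by rewrite -raddfD !low_coefE mcoeffD.
Qed.

Lemma low_coefZ alpha k x : @low_coef alpha (k *: x) = k * low_coef x.
Proof.
by have [a ->] := quot_pi_surj x; rewrite -linearZ !low_coefE mcoeffZ.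
Qed.

Lemma mpolyUn (i : 'I_n) d : 'X_i ^+ d = 'X_[U_(i) *+ d] :> P.
Proof. exact: mpolyXn. Qed.

Variables (k : 'I_n -> nat) (Q : idealr P).
Hypothesis Qk : generated_by_powers k Q.

Lemma power_in_gen i d : (k i <= d)%N -> 'X_i ^+ d \in Q.
Proof.
move=> le; apply/Qk.
exists (fun j => if j == i then 'X_i ^+ (d - k i)%N else 0).
rewrite (bigD1 i) //= eqxx big1 => [|j /negPf->]; last by rewrite mul0r.
by rewrite addr0 -exprD subnK.
Qed.

Lemma gen_sub (J : idealr P) : (forall i, 'X_i ^+ k i \in J) -> {subset Q <= J}.
Proof.
move=> XJ f /Qk[c ->]; apply: rpred_sum => i _; exact: idealMr.
Qed.

Lemma mnm_in_gen (alpha : 'X_{1..n}) i : (k i <= alpha i)%N -> 'X_[alpha] \in Q.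
Proof.
move=> le; have -> : alpha = ((alpha - U_(i) *+ k i) + U_(i) *+ k i)%MM.
  rewrite submK //; apply/mnm_lepP => j; rewrite mulmnE mnm1E.
  by case: eqP => [<-|_]; rewrite ?mul1n ?mul0n.
by rewrite mpolyXD idealMr // -mpolyUn power_in_gen.
Qed.

Lemma power_low (alpha : 'X_{1..n}) i d : (alpha i < d)%N ->
  ('X_i ^+ d : P) \in low_ideal alpha.
Proof.
move=> lt; apply/low_idealP => beta /mnm_lepP le; rewrite mcoeffXn.
case: eqP => // E; have := le i; rewrite -E mulmnE mnm1E eqxx mul1n => le'.
by have := leq_ltn_trans le' lt; rewrite ltnn.
Qed.

(** Every other monomial lies in [Q], so these span the quotient; the induction form replaces an
    explicit finite expansion. *)
Lemma quot_gen_ind (R : quot_alg Q -> Prop) : R 0 ->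
  (forall c u v, R u -> R v -> R (c *: u + v)) ->
  (forall alpha : 'X_{1..n}, (forall i, alpha i < k i)%N -> R (quot_pi Q 'X_[alpha])) ->
  forall u, R u.
Proof.
move=> R0 RL RX u; have [f ->] := quot_pi_surj u.
elim/mpolyind: f => [|c m f _ _ Rf]; first by rewrite raddf0.
rewrite quot_piD quot_piZ; apply: RL => //.
have [/forallP/RX //|] := boolP [forall i, (m i < k i)%N].
rewrite negb_forall => /existsP[i]; rewrite -leqNgt => le.
suff -> : quot_pi Q 'X_[m] = 0 by [].
by apply/eqP; rewrite quot_pi_eq0 (mnm_in_gen le).
Qed.

Lemma nilp_quot (f : P) : f@_0%MM = 0 -> nilp (quot_pi Q f).
Proof.
(* Subtracting the constant term makes the claim unconditional, so that it passes through the
   induction on terms; a nonconstant monomial contains some X_i, which is nilpotent modulo [Q]. *)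
suff H : nilp (quot_pi Q (f - (f@_0%MM)%:MP)).
  by move=> f0; move: H; rewrite f0 mpolyC0 subr0.
elim/mpolyind: f => [|c m f _ _ IH].
  by exists 1%N; rewrite mcoeff0 mpolyC0 subr0 raddf0 expr1.
rewrite mcoeffD mpolyCD opprD addrACA quot_piD; apply: nilpD => //.
rewrite mcoeffZ mcoeffX; have [->|m0] := eqVneq m 0%MM.
  by exists 1%N; rewrite mulr1 mpolyX0 -alg_mpolyC subrr raddf0 expr1.
have [i mi] : exists i, m i != 0%N.
  apply/existsP; rewrite -negb_forall; apply: contra m0 => /forallP m0.
  by apply/eqP/mnmP => i; rewrite mnm0E; apply/eqP.
rewrite mulr0 mpolyC0 subr0.
have -> : m = ((m - U_(i)) + U_(i))%MM by rewrite submK // lep1mP.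
rewrite mpolyXD -mul_mpolyC mulrA rmorphM; apply: nilpM.
by exists (k i); apply/eqP; rewrite -rmorphXn quot_pi_eq0 power_in_gen.
Qed.

(** The constant term decides: the quotient is local with residue field K and nilpotent maximal
    ideal. Stating the unit case through a nilpotent [1 - c^-1 *: u] gives the inverse as a finite
    geometric series. *)
Lemma quot_local (u : quot_alg Q) :
  nilp u \/ exists2 c : K, c != 0 & nilp (1 - c^-1 *: u).
Proof.
have [f ->] := quot_pi_surj u; have [/nilp_quot|c0] := eqVneq (f@_0%MM) 0.
  by left.
right; exists f@_0%MM => //; rewrite -(quot_pi1 Q) -quot_piZ -raddfB.
by apply: nilp_quot; rewrite mcoeffB mcoeffZ mcoeff1 eqxx mulVf // subrr.
Qed.

End MonomialIdeals.

(** * Composites of derivations; partial and Euler derivations of polynomial rings *)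

Section DerivationCombinators.
Variables (K : fieldType) (A B C : comAlgType K).

Lemma derivation_postcomp (g : {lrmorphism A -> C}) (D : A -> A) :
  derivation_along id D -> derivation_along g (g \o D).
Proof.
move=> [DD DM DC]; split=> [a b|a b|k] /=; first by rewrite DD rmorphD.
  by rewrite DM rmorphD !rmorphM.
by rewrite DC rmorph0.
Qed.

Lemma derivation_precomp (g : A -> C) (f : {lrmorphism A -> B}) (D e : B -> C) :
  derivation_along e D -> (forall a, g a = e (f a)) -> derivation_along g (D \o f).
Proof.
move=> [DD DM DC] gE; split=> [a b|a b|k] /=; first by rewrite rmorphD DD.
  by rewrite rmorphM DM !gE.
by rewrite linearZ rmorph1 DC.
Qed.

Lemma derivation_linB (g D1 D2 : A -> C) (c : K) :
  derivation_along g D1 -> derivation_along g D2 ->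
  derivation_along g (fun a => c *: D1 a - D2 a).
Proof.
move=> [D1D D1M D1C] [D2D D2M D2C]; split=> [a b|a b|k].
- by rewrite D1D D2D scalerDr opprD addrACA.
- by rewrite D1M D2M scalerDr !scalerAr !mulrBr opprD addrACA.
- by rewrite D1C D2C scaler0 subrr.
Qed.

End DerivationCombinators.

Section PolynomialDerivations.
Variables (K : fieldType) (n : nat).
Local Notation P := {mpoly K[n]}.

Lemma mderiv_derivation i : derivation_along id (@mderiv n K i).
Proof.
split=> [a b|a b|k]; first exact: mderivD.
  by rewrite mderivM; ring.
by rewrite alg_mpolyC mderivC.
Qed.

Lemma mderivXn (i l : 'I_n) d :
  ('X_l ^+ d : P)^`M(i) = if l == i then d%:R *: 'X_i ^+ d.-1 else 0.
Proof.
elim: d => [|d IH].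
  by rewrite expr0 -mpolyC1 mderivC scale0r; case: ifP.
rewrite exprS mderivM IH mderivX mnm1E; case: eqP => [->|_]; last first.
  by rewrite scale0r mul0r mulr0 addr0.
have -> : (U_(i) - U_(i))%MM = 0%MM by apply/mnmP=> u; rewrite mnmBE mnm0E subnn.
rewrite mpolyX0 scale1r mul1r; case: d {IH} => [|d] /=.
  by rewrite scale0r mulr0 addr0 scale1r.
by rewrite -scalerAr -exprS -[X in X + _]scale1r -scalerDl addrC natr1.
Qed.

Definition euler (f : P) : P := \sum_i 'X_i * f^`M(i).

Lemma euler_derivation : derivation_along id euler.
Proof.
split=> [a b|a b|k]; rewrite /euler.
- by rewrite -big_split; apply: eq_bigr => i _; rewrite mderivD mulrDr.
- rewrite !mulr_sumr -big_split; apply: eq_bigr => i _ /=; rewrite mderivM; ring.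
- by rewrite big1 // => i _; rewrite alg_mpolyC mderivC mulr0.
Qed.

Lemma eulerZ (c : K) f : euler (c *: f) = c *: euler f.
Proof.
by rewrite /euler scaler_sumr; apply: eq_bigr => i _; rewrite mderivZ scalerAr.
Qed.

Lemma eulerX m : euler 'X_[m] = (mdeg m)%:R *: 'X_[m].
Proof.
rewrite /euler mdegE natr_sum scaler_suml; apply: eq_bigr => i _.
rewrite mderivX -scalerAr; have [->|mi] := eqVneq (m i) 0%N.
  by rewrite !scale0r.
by rewrite -mpolyXD addmC submK // lep1mP.
Qed.

Lemma euler_homog d (f : P) : f \is d.-homog -> euler f = d%:R *: f.
Proof.
have [eD _ _] := euler_derivation; move=> /dhomog_mf hf.
have e0 : euler 0 = 0 by rewrite -(scale0r (0 : P)) eulerZ !scale0r.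
rewrite {1}(mpolyE f) (big_morph _ eD e0) [in RHS](mpolyE f) scaler_sumr.
rewrite !big_seq; apply: eq_bigr => m /hf md.
have {}md : mdeg m = d := md; by rewrite eulerZ eulerX md !scalerA mulrC.
Qed.

Lemma gen_derivation0 (k : 'I_n -> nat) (Q : idealr P) (C : comNzRingType)
    (g D : P -> C) :
  generated_by_powers k Q -> derivation_along g D ->
  (forall i, g ('X_i ^+ k i) = 0) -> (forall i, D ('X_i ^+ k i) = 0) ->
  forall f, f \in Q -> D f = 0.
Proof.
move=> Qk [DD DM DC] g0 D0 f /Qk[c ->].
have D00 : D 0 = 0 by rewrite -(scale0r 1) DC.
by rewrite (big_morph _ DD D00) big1 // => i _; rewrite DM g0 D0 mulr0 mul0r addr0.
Qed.

End PolynomialDerivations.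

(** * Additive spans and generators of the graded modules of differentials *)

Section AddSpan.
Variables (M : zmodType) (S : M -> Prop).

Lemma add_span_gen w : S w -> add_span S w.
Proof. by exists [:: w]; rewrite big_seq1; split=> // v; rewrite inE => /eqP->. Qed.

Lemma add_span0 : add_span S 0.
Proof. by exists [::]; rewrite big_nil; split. Qed.

Lemma add_spanD v w : add_span S v -> add_span S w -> add_span S (v + w).
Proof.
move=> [s [sS ->]] [t [tS ->]]; exists (s ++ t); rewrite big_cat; split=> // u.
by rewrite mem_cat => /orP[/sS|/tS].
Qed.

Lemma add_span_sum (I : Type) (r : seq I) (P : pred I) (F : I -> M) :
  (forall i, P i -> add_span S (F i)) -> add_span S (\sum_(i <- r | P i) F i).
Proof.
by move=> H; apply: (big_ind (add_span S)) => //; [apply: add_span0 | apply: add_spanD].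
Qed.

Lemma add_span_ind (R : M -> Prop) : R 0 -> (forall v w, R v -> R w -> R (v + w)) ->
  (forall w, S w -> R w) -> forall v, add_span S v -> R v.
Proof.
move=> R0 RD RS v [s [sS ->]]; rewrite big_seq.
by apply: (big_ind R) => // w /sS/RS.
Qed.

End AddSpan.

(* Multilinear expansion of [wedge t], one coordinate of [s] at a time; [d] and
   [delta] keep track of the degrees of the coefficients. *)
Lemma wedge_expand (A : comNzRingType) (M : lmodType A) (m : nat) (L : finType)
    (u : L -> M) (eta : A) (T H : nat -> A -> Prop) (delta : 'I_m -> nat) :
  (forall d e a b, T d a -> H e b -> T (d + e)%N (a * b)) ->
  forall (s : seq 'I_m) (t : {ffun 'I_m -> M}), uniq s ->
  (forall i, i \in s -> exists r : L -> A,
     (forall l, H (delta i) (r l)) /\ eta *: t i = \sum_l r l *: u l) ->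
  (forall i, i \notin s -> exists l, t i = u l) ->
  forall d b, T d b ->
  add_span (fun w => exists b' (h : {ffun 'I_m -> L}),
    T (d + \sum_(i <- s) delta i)%N b' /\ w = b' *: wedge [ffun i => u (h i)])
    ((b * eta ^+ size s) *: wedge t).
Proof.
move=> TM; elim=> [|i s IH] t /= us ts tu d b Tb.
  apply: add_span_gen; exists b.
  have /fin_all_exists[h hE] i : exists l, t i = u l by apply: tu.
  exists (finfun h); rewrite big_nil addn0 mulr1; split=> //; congr (_ *: wedge _).
  by apply/ffunP=> i; rewrite !ffunE hE.
case/andP: us => nis us.
have [r [Hr rE]] := ts i (mem_head _ _).
rewrite exprSr mulrA -scalerA.
have -> : eta *: wedge t = \sum_l r l *: wedge (upd t i (u l)).
  rewrite -{1}(upd_id t i) -wedge_updZ rE wedge_upd_sum.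
  by apply: eq_bigr => l _; rewrite wedge_updZ.
rewrite scaler_sumr; apply: add_span_sum => l _; rewrite scalerA mulrAC.
rewrite big_cons addnA; apply: IH => // [j js|j js|].
- have [|r' [Hr' r'E]] := ts j; first by rewrite inE js orbT.
  by exists r'; split=> //; rewrite ffunE; case: eqP js nis => // -> ->.
- rewrite ffunE; case: eqP => [_|/eqP ji]; first by exists l.
  by apply: tu; rewrite inE negb_or ji.
- exact: TM.
Qed.

(** Generation by linear forms is encoded as an induction principle on homogeneous elements that
    keeps track of the degree, which is the way it is used below. *)
Definition generated_in_degree1 (K : fieldType) (A : comAlgType K)
    (G : grading A) (r : nat) (x : 'I_r -> A) : Prop :=
  (forall i, G 1%N (x i)) /\
  forall R : nat -> A -> Prop, (forall d, R d 0) ->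
    (forall d c a b, R d a -> R d b -> R d (c *: a + b)) -> R 0%N 1 ->
    (forall d i a, G d a -> R d a -> R d.+1 (x i * a)) ->
    forall d a, G d a -> R d a.

Section GradedDifferentials.
Variables (K : fieldType) (A : comAlgType K) (G : grading A).
Variables (r : nat) (x : 'I_r -> A) (Gx : generated_in_degree1 G x).

Lemma gr_sum d (I : Type) (s : seq I) (P : pred I) (F : I -> A) :
  (forall i, P i -> G d (F i)) -> G d (\sum_(i <- s | P i) F i).
Proof. by move=> H; apply: (big_ind (G d)) => //; [apply: gr_0 | apply: gr_add]. Qed.

Lemma gr_exp d e a : G d a -> G (e * d)%N (a ^+ e).
Proof.
move=> Ga; elim: e => [|e IH]; first by rewrite expr0; apply: gr_1.
by rewrite exprS mulSn; apply: gr_M.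
Qed.

Lemma gr_const c : G 0%N (c%:A : A).
Proof. by apply: gr_scale; apply: gr_1. Qed.

(** Otherwise the point would contain every form of positive degree, against [pt_relevant]. *)
Lemma exists_linear_form (pt : proj_point G) : exists i, x i \notin pt.
Proof.
have [[|d] [a [// _ Ga ha]]] := pt_relevant pt.
apply: contrapT => nex; have H i : x i \in pt.
  by apply: contraT => hi; case: nex; exists i.
case/negP: ha; have [_ ind] := Gx.
suff : forall d a, G d a -> (0 < d)%N -> a \in pt by move/(_ _ _ Ga); apply.
apply: ind => //.
- by move=> *; apply: rpred0.
- move=> e c u v Hu Hv e0; rewrite rpredD ?Hv //.
  by rewrite -[u]mul1r scalerAl idealMr ?Hu.
- by move=> e i u _ _ _; rewrite mulrC idealMr.
Qed.

Lemma kdiff_generators d a : G d a -> kdiff a = 0 \/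
  exists2 d', d = d'.+1 & exists2 q : 'I_r -> A,
    forall l, G d' (q l) & kdiff a = \sum_l q l *: kdiff (x l).
Proof.
have [_ ind] := Gx; move: d a; apply: ind => [d|d c a b|//|d i a Ga].
- by left; rewrite kdiff0.
- rewrite kdiffD kdiffZ => -[->|[d1 -> [q1 Gq1 ->]]] [->|[d2 E [q2 Gq2 ->]]].
  + by left; rewrite scaler0 addr0.
  + by rewrite E; right; exists d2 => //; exists q2; rewrite // scaler0 add0r.
  + right; exists d1 => //; exists (fun l => c *: q1 l).
      by move=> l; apply: gr_scale.
    rewrite addr0 scaler_sumr; apply: eq_bigr => l _.
    by rewrite scalerA -scalerAl mul1r.
  + right; exists d1 => //; exists (fun l => c *: q1 l + q2 l).
      by move=> l; case: E Gq2 => <- Gq2; apply: gr_lin.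
    rewrite scaler_sumr -big_split; apply: eq_bigr => l _ /=.
    by rewrite scalerA -scalerAl mul1r scalerDl.
- by left; rewrite -(scale1r 1) kdiffC.
case=> [a0|[d' dE [q Gq qE]]]; right; exists d => //.
  exists (fun l => if l == i then a else 0).
    by move=> l; case: eqP => _ //; apply: gr_0.
  rewrite kdiffM a0 scaler0 add0r (bigD1 i) //= eqxx big1 ?addr0 // => l.
  by move/negPf->; rewrite scale0r.
exists (fun l => (if l == i then a else 0) + x i * q l).
  move=> l; apply: gr_add; first by case: eqP => _ //; apply: gr_0.
  by rewrite dE -add1n; apply: gr_M; case: Gx.
rewrite kdiffM qE addrC.
under [in RHS]eq_bigr => l _ do rewrite scalerDl -scalerA.
rewrite big_split -scaler_sumr /=; congr (_ + _).
rewrite (bigD1 i) //= eqxx big1 ?addr0 // => l.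
by move/negPf->; rewrite scale0r.
Qed.

Lemma kaehler_gr_generators d w : kaehler_gr G d w -> w = 0 \/
  exists2 d', d = d'.+1 & exists2 q : 'I_r -> A,
    forall l, G d' (q l) & w = \sum_l q l *: kdiff (x l).
Proof.
move: w; apply: add_span_ind; first by left.
  move=> v w [->|[d1 -> [q1 Gq1 ->]]] [->|[d2 E [q2 Gq2 ->]]].
  - by left; rewrite addr0.
  - by right; exists d2 => //; exists q2; rewrite // add0r.
  - by right; exists d1 => //; exists q1; rewrite // addr0.
  right; exists d1 => //; exists (fun l => q1 l + q2 l).
    by move=> l; case: E Gq2 => <- Gq2; apply: gr_add.
  by rewrite -big_split; apply: eq_bigr => l _; rewrite scalerDl.
move=> w [i [j [a [b [<- Ga Gb ->]]]]].
have [->|[d' -> [q Gq ->]]] := kdiff_generators Gb; first by left; rewrite scaler0.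
right; exists (i + d')%N; first by rewrite addnS.
exists (fun l => a * q l); first by move=> l; apply: gr_M.
by rewrite scaler_sumr; apply: eq_bigr => l _; rewrite scalerA.
Qed.

Lemma ext_gr_generators m e v : ext_gr G (kaehler_gr G) (m := m) e v ->
  add_span (fun w => exists d b (h : {ffun 'I_m -> 'I_r}),
    [/\ (d + m)%N = e, G d b & w = b *: wedge [ffun i => kdiff (x (h i))]]) v.
Proof.
move: v; apply: add_span_ind; [exact: add_span0|exact: add_spanD|].
move=> w [i [c [a [t [cE Ga ct ->]]]]].
(* A zero factor kills the wedge and is set aside first: only for a nonzero factor does
   [kaehler_gr_generators] give coefficients of degree one less. *)
have [/forallP t0|] := boolP [forall j, t j != 0]; last first.
  rewrite negb_forall => /existsP[j]; rewrite negbK => /eqP tj.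
  by rewrite -(upd_id t j) tj wedge_upd0 scaler0; apply: add_span0.
have H j : exists2 d', c j = d'.+1 & exists2 q : 'I_r -> A,
    forall l, G d' (q l) & t j = \sum_l q l *: kdiff (x l).
  by have [/eqP|//] := kaehler_gr_generators (ct j); rewrite (negPf (t0 j)).
have W := @wedge_expand A _ m 'I_r (fun l => kdiff (x l)) 1 G G (fun j => (c j).-1)
  (@gr_M _ _ G) (enum 'I_m) t (enum_uniq _).
have {W} : add_span (fun w : ext_power (kaehler A) m =>
    exists b' (h : {ffun 'I_m -> 'I_r}),
    G (i + \sum_(i0 <- enum 'I_m) (c i0).-1)%N b' /\
    w = b' *: wedge [ffun i0 => kdiff (x (h i0))]) (a *: wedge t).
  have := W _ _ i a Ga; rewrite expr1n mulr1; apply => j.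
    by have [d' -> [q Gq ->]] := H j; exists q; rewrite scale1r.
  by rewrite mem_enum inE.
move: (a *: wedge t); apply: add_span_ind; [exact: add_span0|exact: add_spanD|].
move=> {}w [b [h [Gb ->]]]; apply: add_span_gen; do 3 eexists; split; [|exact: Gb|by []].
rewrite -addnA -cE big_enum /=; congr (_ + _)%N.
rewrite -[X in (_ + X)%N]card_ord -sum1_card -big_split; apply: eq_bigr => j _ /=.
by have [d' -> _] := H j; rewrite addn1.
Qed.

End GradedDifferentials.

(** * Generators and relations of the differentials near one point *)

Section LocalCharts.
Variables (K : fieldType) (A : comAlgType K) (G : grading A).
Variables (n s : nat) (k : 'I_n -> 'I_s -> nat).
Variable Q : 'I_s -> idealr {mpoly K[n]}.
Hypothesis Qk : forall j, generated_by_powers (k^~ j) (Q j).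
Variable phi : forall j, {lrmorphism A -> quot_alg (Q j)}.
Hypothesis phi_inj : forall d a, G d a -> (forall j, phi j a = 0) -> a = 0.

Definition supported_at (j : 'I_s) (a : A) : Prop :=
  forall i, i != j -> phi i a = 0.

Variable N0 : nat.
Hypothesis phi_surj : forall e j u, (N0 <= e)%N ->
  exists a, [/\ G e a, supported_at j a & phi j a = u].

Lemma supportedM j a b : supported_at j a -> supported_at j (a * b).
Proof. by move=> aj i ij; rewrite rmorphM /= aj // mul0r. Qed.

Lemma supported_lin j c a b :
  supported_at j a -> supported_at j b -> supported_at j (c *: a + b).
Proof. by move=> aj bj i ij; rewrite linearP /= (aj _ ij) (bj _ ij) addr0 scaler0. Qed.

Lemma supported0 j : supported_at j 0.
Proof. by move=> i _; rewrite rmorph0. Qed.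

(** The other charts vanish on both forms, so joint injectivity applies. Identities between forms in
    [A] are thereby checked on values in K[X] / Q_j. *)
Lemma supported_ext j d a b : G d a -> G d b -> supported_at j a ->
  supported_at j b -> phi j a = phi j b -> a = b.
Proof.
move=> Ga Gb aj bj ab; apply/eqP; rewrite -subr_eq0; apply/eqP.
apply: (phi_inj (d := d)) => [|i]; first exact: gr_add Ga (gr_opp Gb).
rewrite rmorphB /=; have [->|ij] := eqVneq i j; first by rewrite ab subrr.
by rewrite (aj _ ij) (bj _ ij) subrr.
Qed.

Variables (N : nat) (N0N : (N0 <= N)%N) (N_neq0 : N%:R != 0 :> K).

Section OneChart.
Variables (j : 'I_s) (z : option 'I_n -> A).
Hypothesis Gz : forall l, G N (z l).
Hypothesis zj : forall l, supported_at j (z l).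
Hypothesis phi_z : forall l,
  phi j (z l) = if l is Some i then quot_pi (Q j) 'X_i else 1.

Local Notation eps := (z None).

Lemma phi_eps : phi j eps = 1. Proof. exact: (phi_z None). Qed.

Lemma gr_eps c : G (c * N)%N (eps ^+ c). Proof. exact: gr_exp. Qed.

Lemma supported_eps c : supported_at j (eps ^+ c.+1).
Proof. by rewrite exprS; apply: supportedM. Qed.

Lemma phi_epsX c : phi j (eps ^+ c) = 1.
Proof. by rewrite rmorphXn /= phi_eps expr1n. Qed.

(* [w], of degree [t], is a combination of the [kdiff (z l)] on the open set
   where [eps] is invertible. *)
Definition chart_span_at c t (w : kaehler A) : Prop :=
  exists2 q : option 'I_n -> A, forall l, G (t + c * N)%N (q l) &
    eps ^+ c.+1 *: w = \sum_l q l *: kdiff (z l).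

Definition chart_span t w : Prop := exists c, chart_span_at c t w.

Lemma chart_span_up c d t w : (c <= d)%N -> chart_span_at c t w -> chart_span_at d t w.
Proof.
move=> /subnK<- [q Gq qE]; exists (fun l => eps ^+ (d - c) * q l).
  by move=> l; rewrite mulnDl addnCA; apply: gr_M => //; apply: gr_eps.
rewrite -addnS exprD -scalerA qE scaler_sumr.
by apply: eq_bigr => l _; rewrite scalerA.
Qed.

Lemma chart_spanD t v w : chart_span t v -> chart_span t w -> chart_span t (v + w).
Proof.
move=> [c1 H1] [c2 H2]; have [q1 Gq1 E1] := chart_span_up (leq_maxl c1 c2) H1.
have [q2 Gq2 E2] := chart_span_up (leq_maxr c1 c2) H2.
exists (maxn c1 c2), (fun l => q1 l + q2 l).
  by move=> l; apply: gr_add.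
rewrite scalerDr E1 E2 -big_split; apply: eq_bigr => l _ /=.
by rewrite scalerDl.
Qed.

Lemma chart_spanZ t e a w : G e a -> chart_span t w -> chart_span (e + t) (a *: w).
Proof.
move=> Ga [c [q Gq qE]]; exists c, (fun l => a * q l).
  by move=> l; rewrite -addnA; apply: gr_M.
rewrite scalerA mulrC -scalerA qE scaler_sumr.
by apply: eq_bigr => l _; rewrite scalerA.
Qed.

Lemma chart_spanB t v w : chart_span t v -> chart_span t w -> chart_span t (v - w).
Proof.
move=> Hv Hw; apply: chart_spanD => //; rewrite -scaleN1r -[t]add0n.
by apply: chart_spanZ => //; apply: gr_opp; apply: gr_1.
Qed.

Lemma chart_span0 t : chart_span t 0.
Proof.
exists 0%N, (fun=> 0); first by move=> l; apply: gr_0.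
by rewrite scaler0 big1 // => l _; rewrite scale0r.
Qed.

Lemma chart_span_div c t w :
  chart_span (c * N + t) (eps ^+ c *: w) -> chart_span t w.
Proof.
move=> [d [q Gq qE]]; exists (d + c)%N, q.
  by move=> l; rewrite mulnDl [(d * N + _)%N]addnC addnA [(t + _)%N]addnC.
by rewrite -addSn exprD -scalerA.
Qed.

Lemma chart_span_scalar c t w : c != 0 -> chart_span t (c%:A *: w) -> chart_span t w.
Proof.
move=> c0 H; have -> : w = c^-1%:A *: (c%:A *: w).
  by rewrite scalerA -scalerAl mul1r scalerA mulVf // !scale1r.
by rewrite -[t]add0n; apply: chart_spanZ => //; apply: gr_const.
Qed.

Lemma chart_span_z l : chart_span N (kdiff (z l)).
Proof.
exists 0%N, (fun l' => if l' == l then eps else 0).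
  by move=> l'; rewrite mul0n addn0; case: eqP => _; [apply: Gz|apply: gr_0].
rewrite expr1 (bigD1 l) //= eqxx big1 ?addr0 // => l' /negPf->.
by rewrite scale0r.
Qed.

Definition chart_elt d a : Prop := G d a /\ chart_span d (kdiff a).

Lemma chart_eltM d e a b : chart_elt d a -> chart_elt e b -> chart_elt (d + e) (a * b).
Proof.
move=> [Ga Ha] [Gb Hb]; split; first exact: gr_M.
rewrite kdiffM; apply: chart_spanD; first exact: chart_spanZ.
by rewrite addnC; apply: chart_spanZ.
Qed.

Lemma chart_elt_lin d c a b :
  chart_elt d a -> chart_elt d b -> chart_elt d (c *: a + b).
Proof.
move=> [Ga Ha] [Gb Hb]; split; first exact: gr_lin.
rewrite kdiffD kdiffZ; apply: chart_spanD => //; rewrite -[d]add0n.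
by apply: chart_spanZ => //; apply: gr_const.
Qed.

Lemma chart_elt1 : chart_elt 0 1.
Proof.
by split; [apply: gr_1 | rewrite -(scale1r 1) kdiffC; apply: chart_span0].
Qed.

Lemma chart_elt_exp d a c : chart_elt d a -> chart_elt (c * d) (a ^+ c).
Proof.
move=> Ha; elim: c => [|c IH]; first exact: chart_elt1.
by rewrite exprS mulSn; apply: chart_eltM.
Qed.

Lemma chart_elt_z l : chart_elt N (z l).
Proof. by split; [apply: Gz | apply: chart_span_z]. Qed.

Lemma chart_elt_eps c : chart_elt (c * N) (eps ^+ c).
Proof. exact: chart_elt_exp (chart_elt_z None). Qed.

(** Products of the [z l] only live in degrees divisible by [N]. Lifts are demanded in all large
    such degrees so that summands can be brought to a common degree. *)
Definition chart_function u : Prop := exists c, forall c', (c <= c')%N ->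
  exists a, [/\ chart_elt (c' * N) a, supported_at j a & phi j a = u].

Lemma chart_functionM u v : chart_function u -> chart_function v -> chart_function (u * v).
Proof.
move=> [c Hu] [d Hv]; exists (c + d)%N => e le.
have [a [Ha aj au]] := Hu c (leqnn c).
have [|b [Hb bj bv]] := Hv (e - c)%N.
  by rewrite leq_subRL // (leq_trans (leq_addr d c)).
exists (a * b); split; last by rewrite rmorphM /= au bv.
  rewrite -[e](subnKC (leq_trans (leq_addr d c) le)) mulnDl.
  exact: chart_eltM.
exact: supportedM.
Qed.

Lemma chart_function1 : chart_function 1.
Proof.
exists 1%N => -[//|c] _; exists (eps ^+ c.+1); split; last exact: phi_epsX.
  exact: chart_elt_eps.
exact: supported_eps.
Qed.

Lemma chart_functionX i : chart_function (quot_pi (Q j) 'X_i).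
Proof.
exists 1%N => -[//|c] _; exists (z (Some i) * eps ^+ c); split.
- by rewrite mulSn; apply: chart_eltM; [apply: chart_elt_z | apply: chart_elt_eps].
- exact: supportedM.
- by rewrite rmorphM /= phi_epsX mulr1 phi_z.
Qed.

Lemma chart_functionP u : chart_function u.
Proof.
apply: (quot_gen_ind (Qk j)) => [|c {}u v [d Hu] [e Hv]|alpha _].
- exists 0%N => c _; exists 0; split; [|exact: supported0|exact: rmorph0].
  by split; [apply: gr_0 | rewrite kdiff0; apply: chart_span0].
- exists (maxn d e) => f; rewrite geq_max => /andP[/Hu[a [Ha aj au]] /Hv[b [Hb bj bv]]].
  exists (c *: a + b); split; [exact: chart_elt_lin | exact: supported_lin|].
  by rewrite linearP /= au bv.
- rewrite mpolyXE_id rmorph_prod; apply: (big_ind chart_function) => [||i _].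
  + exact: chart_function1.
  + exact: chart_functionM.
  + rewrite rmorphXn; elim: (alpha i) => [|d IH]; first exact: chart_function1.
    by rewrite exprS; apply: chart_functionM => //; apply: chart_functionX.
Qed.

(* [tau ^ N = eps ^ (N + 1)] and [N] is invertible, so [eps] controls the
   differentials in degrees that are not multiples of [N]. *)
Lemma chart_elt_tau tau : G N.+1 tau -> supported_at j tau -> phi j tau = 1 ->
  chart_elt N.+1 tau.
Proof.
move=> Gt tj pt; split=> //.
have N_gt0 : (0 < N)%N by case: (N) N_neq0 => //; rewrite eqxx.
have E : tau ^+ N = eps ^+ N.+1.
  apply: (@supported_ext j (N * N.+1)).
  - exact: gr_exp.
  - by rewrite mulnC; apply: gr_eps.
  - by rewrite -(prednK N_gt0) exprS; apply: supportedM.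
  - exact: supported_eps.
  - by rewrite phi_epsX rmorphXn /= pt expr1n.
have [N' NE] : exists N', N = N'.+1 by exists N.-1; rewrite prednK.
(* The factor [tau] turns the tau^(N-1) coming from d(tau^N) into tau^N = eps^(N+1), leaving N
   eps^(N+1) d tau = (N+1) tau eps^N d eps. *)
have F := congr1 (fun a => tau *: kdiff a) E.
rewrite /= [in tau ^+ N]NE !kdiffX -NE in F.
have {}F : N%:R%:A *: (eps ^+ N.+1 *: kdiff tau) =
           (tau * N.+1%:R%:A) *: (eps ^+ N *: kdiff eps).
  rewrite -[in RHS]scalerA -F !scalerA; congr (_ *: _).
  by rewrite -E [in tau ^+ N]NE exprS; ring.
apply: (@chart_span_div N.+1); apply: (chart_span_scalar N_neq0); rewrite F.
have -> : (N.+1 * N + N.+1 = N.+1 + (N * N + N))%N by ring.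
apply: chart_spanZ; first by rewrite -[N.+1]addn0; apply: gr_M => //; apply: gr_const.
by apply: chart_spanZ; [apply: gr_eps | apply: chart_span_z].
Qed.

(** Multiplied by eps^(c+1), the linear form becomes b tau, with b of degree cN having the same
    value and tau of degree N + 1 having value 1. The differentials of b, tau and eps are known, and
    the Leibniz rule isolates d a. *)
Lemma chart_span_kdiff a : G 1 a -> chart_span 1 (kdiff a).
Proof.
move=> Ga; have [c /(_ c (leqnn c))[b [Hb bj bu]]] := chart_functionP (phi j a).
have [tau [Gt tj pt]] := phi_surj (1 : quot_alg (Q j)) (leq_trans N0N (leqnSn N)).
have Ht := chart_elt_tau Gt tj pt.
have dE : (c.+1 * N + 1 = c * N + N.+1)%N by rewrite mulSn; ring.
have E : eps ^+ c.+1 * a = b * tau.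
  apply: (@supported_ext j (c.+1 * N + 1)).
  - by apply: gr_M => //; apply: gr_eps.
  - by rewrite dE; case: (chart_eltM Hb Ht).
  - by apply: supportedM; apply: supported_eps.
  - exact: supportedM.
  - by rewrite !rmorphM /= phi_epsX bu pt mul1r mulr1.
apply: (@chart_span_div c.+1).
have -> : eps ^+ c.+1 *: kdiff a = kdiff (b * tau) - a *: kdiff (eps ^+ c.+1).
  by rewrite -E kdiffM addrK.
apply: chart_spanB.
  by rewrite dE; case: (chart_eltM Hb Ht).
rewrite addnC; apply: chart_spanZ => //.
by have [] := chart_elt_eps c.+1.
Qed.

(** Obtained by differentiating eps y^k = 0; one more factor eps removes the term y^k d eps, whence
    the square. *)
Lemma chart_relation i : (0 < k i j)%N -> (k i j)%:R != 0 :> K ->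
  (eps ^+ 2 * z (Some i) ^+ (k i j).-1) *: kdiff (z (Some i)) = 0.
Proof.
move=> k0 kK; set y := z (Some i).
have E : eps * y ^+ k i j = 0.
  apply: (@supported_ext j (N + k i j * N)).
  - by apply: gr_M; [apply: Gz | apply/gr_exp/Gz].
  - exact: gr_0.
  - exact: supportedM.
  - exact: supported0.
  - rewrite rmorph0 rmorphM rmorphXn /= phi_eps phi_z mul1r.
    by apply/eqP; rewrite -rmorphXn quot_pi_eq0 (power_in_gen (Qk j)).
have := congr1 (fun a => eps *: kdiff a) E; rewrite /= kdiff0 scaler0 kdiffM.
rewrite scalerDr !scalerA E scale0r addr0; case: (k i j) k0 kK => // k' _ kK.
rewrite kdiffX /= => /(congr1 (fun w => k'.+1%:R^-1%:A *: w)).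
rewrite scaler0 => <-; rewrite !scalerA; congr (_ *: _).
rewrite expr2 -!scalerAl mul1r -scalerAr -scalerAl mulr1.
by rewrite scalerA mulVf // scale1r.
Qed.

Section Wedges.
Variable m : nat.
Hypothesis k_gt0 : forall i, (0 < k i j)%N.

(** [None] stands for d eps_j. The default of [nth] is reached only if [S] has fewer than [m]
    elements. *)
Definition chart_wedge (S : {set option 'I_n}) : ext_power (kaehler A) m :=
  wedge [ffun l : 'I_m => kdiff (z (nth None (enum S) l))].

(** Such a form is divisible by eps^2 y^(k-1), which annihilates d y. That factor has degree (k+1)N,
    and the bound on [e] leaves at least [N0] for the cofactor. *)
Lemma chart_wedge_relation (S : {set option 'I_n}) i e a (alpha : 'X_{1..n}) :
  #|S| = m -> Some i \in S -> (k i j)%:R != 0 :> K ->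
  ((k i j).-1 <= alpha i)%N -> (N0 + (k i j).+1 * N <= e)%N ->
  G e a -> supported_at j a -> phi j a = quot_pi (Q j) 'X_[alpha] ->
  a *: chart_wedge S = 0.
Proof.
move=> Sm iS kK le leN Ga aj pa; set y := z (Some i).
have le' : ((k i j).+1 * N <= e)%N by apply: leq_trans leN; apply: leq_addl.
have [|b [Gb bj bu]] := @phi_surj (e - (k i j).+1 * N) j
    (quot_pi (Q j) 'X_[alpha - U_(i) *+ (k i j).-1]); first by rewrite leq_subRL // addnC.
have aE : a = b * (eps ^+ 2 * y ^+ (k i j).-1).
  apply: (supported_ext Ga _ aj).
  - rewrite -(subnK le'); apply: gr_M => //.
    rewrite -{1}(prednK (k_gt0 i)) -add2n mulnDl.
    by apply: gr_M; apply/gr_exp/Gz.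
  - exact: supportedM.
  - rewrite pa 2!rmorphM /= phi_epsX mul1r rmorphXn /= phi_z bu -rmorphXn -rmorphM.
    rewrite mpolyUn -mpolyXD submK //; apply/mnm_lepP => l.
    by rewrite mulmnE mnm1E; case: eqP => [<-|_]; rewrite ?mul1n ?mul0n.
have lt : (index (Some i) (enum S) < m)%N by rewrite -Sm cardE index_mem mem_enum.
rewrite aE -scalerA /chart_wedge; set t := finfun _.
have ti : t (Ordinal lt) = kdiff y by rewrite ffunE /= nth_index // mem_enum.
by rewrite -(upd_id t (Ordinal lt)) -wedge_updZ ti chart_relation // wedge_upd0 scaler0.
Qed.

(** Number of exponents of X_i that survive next to the wedge of [S]; the product over i is a
    summand of the formula. *)
Definition reduced_exp (S : {set option 'I_n}) i : nat :=
  if (Some i \in S) && ((k i j)%:R != 0 :> K) then (k i j).-1 else k i j.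

Variables (e : nat) (R : ext_power (kaehler A) m -> Prop).
Hypothesis R0 : R 0.
Hypothesis RL : forall c v w, R v -> R w -> R (c%:A *: v + w).
Hypothesis Rbasis : forall (S : {set option 'I_n}) (alpha : 'X_{1..n}) a, #|S| = m ->
  (forall i, (alpha i < reduced_exp S i)%N) ->
  G e a -> supported_at j a -> phi j a = quot_pi (Q j) 'X_[alpha] ->
  R (a *: chart_wedge S).
Hypothesis e_large : forall i, (N0 + (k i j).+1 * N <= e)%N.
Hypothesis N0e : (N0 <= e)%N.

(** [R] stands for the K-span of the candidate basis in degree [e]; keeping it abstract separates
    the reduction from the enumeration of the basis. Monomials with too large an exponent disappear
    by [chart_wedge_relation]. *)
Lemma chart_wedge_span (S : {set option 'I_n}) a : #|S| = m -> G e a ->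
  supported_at j a -> R (a *: chart_wedge S).
Proof.
move=> Sm; move uE : (phi j a) => u; move: u a uE.
apply: (quot_gen_ind (Qk j)) => [a a0|c u v Hu Hv a aE|alpha lt a aE] Ga aj.
- by rewrite (supported_ext Ga (gr_0 _ _) aj (@supported0 j)) ?rmorph0 // scale0r.
- have [b [Gb bj bu]] := phi_surj u N0e.
  have -> : a *: chart_wedge S =
      c%:A *: (b *: chart_wedge S) + (- c *: b + a) *: chart_wedge S.
    by rewrite scalerA -scalerDl -scalerAl mul1r addrA -scalerDl subrr scale0r add0r.
  apply: RL; first exact: Hu.
  apply: Hv; [|exact: gr_lin|exact: supported_lin].
  by rewrite linearP /= bu aE addrA -scalerDl addNr scale0r add0r.
have [/forallP lt'|] := boolP [forall i, (alpha i < reduced_exp S i)%N].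
  exact: (Rbasis Sm lt').
rewrite negb_forall => /existsP[i]; rewrite /reduced_exp.
case: ifP => [/andP[iS kK]|_]; last by rewrite lt.
by rewrite -leqNgt => le; rewrite (chart_wedge_relation Sm iS kK le (e_large i) Ga aj aE).
Qed.

(** A repeated differential gives zero; otherwise [h] enumerates its image up to a permutation,
    which costs a sign. *)
Lemma wedge_z_span (h : {ffun 'I_m -> option 'I_n}) a : G e a ->
  supported_at j a -> R (a *: wedge [ffun l => kdiff (z (h l))]).
Proof.
move=> Ga aj; have [/injectiveP hI|/injectivePn[l [l' ll' hll']]] := boolP (injectiveb h).
  pose S := [set h l | l : 'I_m].
  have Sm : #|S| = m by rewrite card_imset // card_ord.
  have ltS l : (index (h l) (enum S) < m)%N.
    by rewrite -[X in (_ < X)%N]Sm cardE index_mem mem_enum imset_f.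
  have sI : injective (fun l => Ordinal (ltS l)).
    move=> l l' /(congr1 (fun i => nth None (enum S) (val i))) /=.
    by rewrite !nth_index ?mem_enum ?imset_f // => /hI.
  have -> : [ffun l => kdiff (z (h l))] =
     [ffun l => [ffun l : 'I_m => kdiff (z (nth None (enum S) l))] (perm sI l)].
    by apply/ffunP=> l; rewrite !ffunE permE /= nth_index // mem_enum imset_f.
  rewrite wedge_perm scalerA; apply: chart_wedge_span => //; last exact: supportedM.
  by rewrite mulrC mulr_sign; case: ifP => // _; apply: gr_opp.
by rewrite (wedge_alt ll') ?scaler0 // !ffunE hll'.
Qed.

(** Each of the m factors d x absorbs one eps^(c+1) and returns a coefficient of degree 1 + cN,
    whence the exponent [m] and the degree [e]. *)
Lemma wedge_generators_span (r : nat) (x : 'I_r -> A) c (h : {ffun 'I_m -> 'I_r}) d a :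
  (forall i, chart_span_at c 1 (kdiff (x i))) -> (d + m * (1 + c * N) = e)%N ->
  G d a -> supported_at j a ->
  R ((a * eps ^+ c.+1 ^+ m) *: wedge [ffun l => kdiff (x (h l))]).
Proof.
move=> Hx dE Ga aj.
have := @wedge_expand A (kaehler A) m (option 'I_n) (fun l => kdiff (z l)) (eps ^+ c.+1)
  (fun d a => G d a /\ supported_at j a) G (fun=> 1 + c * N)%N _ (enum 'I_m)
  [ffun l => kdiff (x (h l))] (enum_uniq _) _ _ d a (conj Ga aj).
rewrite size_enum_ord big_enum sum_nat_const card_ord dE => W.
have {W} : add_span (fun w => exists b (h : {ffun 'I_m -> option 'I_n}),
    (G e b /\ supported_at j b) /\ w = b *: wedge [ffun i => kdiff (z (h i))])
    ((a * eps ^+ c.+1 ^+ m) *: wedge [ffun l => kdiff (x (h l))]).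
  apply: W => [d1 d2 a1 a2 [G1 j1] G2|i _|i].
  - by split; [apply: gr_M | apply: supportedM].
  - by have [q Gq qE] := Hx (h i); exists q; rewrite ffunE.
  - by rewrite mem_enum.
move: (_ *: _); apply: add_span_ind => // [v w Rv Rw|w [b [h' [[Gb bj] ->]]]].
  by have := RL 1 Rv Rw; rewrite !scale1r.
exact: wedge_z_span.
Qed.

End Wedges.
End OneChart.
End LocalCharts.

(** * Dual functionals and linear independence *)

Section Coordinates.
Variables (K : fieldType) (A : comAlgType K) (G : grading A).
Variables (n s : nat) (k : 'I_n -> 'I_s -> nat).
Variable Q : 'I_s -> idealr {mpoly K[n]}.
Hypothesis Qk : forall j, generated_by_powers (k^~ j) (Q j).
Variable phi : forall j, {lrmorphism A -> quot_alg (Q j)}.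
Variables (N : nat) (N_neq0 : N%:R != 0 :> K).
Variable z : 'I_s -> option 'I_n -> A.
Hypothesis Gz : forall j l, G N (z j l).
Hypothesis phi_z : forall j l,
  phi j (z j l) = if l is Some i then quot_pi (Q j) 'X_i else 1.
Variable eul : A -> A.
Hypothesis eulD : derivation_along id eul.
Hypothesis eul_homog : forall d a, G d a -> eul a = d%:R *: a.
Variable m : nat.

Lemma reduced_exp_le j S i : (reduced_exp K k j S i <= k i j)%N.
Proof. by rewrite /reduced_exp; case: ifP => // _; apply: leq_pred. Qed.

Section Coordinate.
Variables (j : 'I_s) (S : {set option 'I_n}) (alpha : 'X_{1..n}).
Hypothesis Sm : #|S| = m.
Hypothesis alpha_lt : forall i, (alpha i < reduced_exp K k j S i)%N.
Local Notation C := (quot_alg (@low_ideal K n alpha)).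
Local Notation pi := (quot_pi (@low_ideal K n alpha)).

Let alpha_ltk i : (alpha i < k i j)%N.
Proof. exact: leq_trans (alpha_lt i) (reduced_exp_le _ _ _). Qed.

Let pi_power i : pi ('X_i ^+ k i j) = 0.
Proof. by apply/eqP; rewrite quot_pi_eq0 power_low. Qed.

(** The obstruction to descending d/dX_i is k_ij X_i^(k_ij - 1). It vanishes modulo X_i^(alpha_i +
    1): either k_ij is zero in K, or alpha_i < k_ij - 1 by the bound [reduced_exp], since [Some i]
    is in [S]. *)
Lemma chart_derivations : exists g : {lrmorphism A -> C},
  (forall a f, phi j a = quot_pi (Q j) f -> g a = pi f) /\
  exists D : option 'I_n -> A -> C, forall l, l \in S ->
    derivation_along g (D l) /\ forall l', D l (z j l') = (l == l')%:R.
Proof.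
have [|pr prE] := @quot_factor _ _ (Q j) (low_ideal alpha).
  by apply: (gen_sub (Qk j)) => i; apply: power_low.
have [g gE] : exists g : {lrmorphism A -> C}, forall a, g a = pr (phi j a).
  by exists [the {lrmorphism _ -> _} of pr \o phi j].
have {gE} [gE gpr] : (forall a f, phi j a = quot_pi (Q j) f -> g a = pi f) /\
  (forall a, g a = pr (phi j a)).
  by split=> // a f E; rewrite gE E prE.
exists g; split=> //.
have comp (D0 : {mpoly K[n]} -> {mpoly K[n]}) : derivation_along id D0 ->
    (forall i, pi (D0 ('X_i ^+ k i j)) = 0) ->
    exists2 D : A -> C, derivation_along g D &
      forall a f, phi j a = quot_pi (Q j) f -> D a = pi (D0 f).
  move=> D0D D0X; have D1 := derivation_quot_pi (@low_ideal K n alpha) D0D.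
  have D1Q := gen_derivation0 (Qk j) D1 pi_power D0X.
  have [F FD FE] := quot_derivation D1 D1Q prE.
  exists (F \o phi j); first exact: derivation_precomp FD gpr.
  by move=> a f /= ->; apply: FE.
suff H l : l \in S -> exists D : A -> C,
    derivation_along g D /\ forall l', D (z j l') = (l == l')%:R.
  have /choice[D HD] : forall l, exists D : A -> C, l \in S ->
      derivation_along g D /\ forall l', D (z j l') = (l == l')%:R.
    move=> l; have [/H[D HD]|lS] := boolP (l \in S); first by exists D.
    by exists (fun=> 0).
  by exists D.
case: l => [i|] lS.
  have [|D DD DE] := comp _ (mderiv_derivation K i).
    move=> l; rewrite mderivXn; case: eqP => [->|_]; last by rewrite raddf0.
    have := alpha_lt i; rewrite /reduced_exp lS /=.
    case: eqP => [-> _|_ lt]; first by rewrite scale0r raddf0.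
    apply/eqP; rewrite quot_piZ; apply/eqP.
    have /eqP -> : pi ('X_i ^+ (k i j).-1) == 0 by rewrite quot_pi_eq0 power_low.
    by rewrite scaler0.
  exists D; split=> // -[i'|].
    rewrite (DE _ 'X_i'); last exact: (phi_z j (Some i')).
    rewrite -['X_i']expr1 mderivXn expr0 scale1r eq_sym; case: eqP => [->|ne].
      by rewrite eqxx rmorph1.
    by rewrite raddf0; case: eqP => // -[].
  rewrite (DE _ 1); last by rewrite quot_pi1; exact: (phi_z j None).
  by rewrite -mpolyC1 mderivC raddf0.
have [|F FD FE] := comp _ (euler_derivation K n).
  move=> i; rewrite mpolyUn eulerX -mpolyUn quot_piZ pi_power.
  exact: scaler0.
(* [eul] multiplies [z j l'] by its degree [N], so the first term returns its value; [F], the Euler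
   operator in the affine coordinates, fixes X_i and kills 1. The difference is 0 on y_ij and 1 on
   eps_j. *)
exists (fun a => N%:R^-1 *: g (eul a) - F a); split.
  exact: derivation_linB (derivation_postcomp g eulD) FD.
move=> l'; rewrite (eul_homog (Gz j l')) linearZ /= scalerA mulVf // scale1r.
case: l' => [i'|].
  rewrite (gE _ 'X_i') ?(FE _ 'X_i') ?(phi_z j (Some i')) //.
  by rewrite eulerX mdeg1 scale1r subrr.
rewrite (gE _ 1) ?(FE _ 1) ?quot_pi1 ?(phi_z j None) // eqxx.
by rewrite -mpolyX0 eulerX mdeg0 scale0r raddf0 subr0.
Qed.

(** The determinant of the derivations of [S] on the wedge of [S'] is 1 or 0, and the coefficient at
    X^alpha then tells the monomials apart; the outcome is a true dual family, with no triangularity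
    argument. *)
Lemma coordinate : exists f : ext_power (kaehler A) m -> K,
  [/\ {morph f : v w / v + w}, forall c v, f (c%:A *: v) = c * f v
    & forall j' (S' : {set option 'I_n}) (alpha' : 'X_{1..n}) a, #|S'| = m ->
      supported_at phi j' a -> phi j' a = quot_pi (Q j') 'X_[alpha'] ->
      f (a *: chart_wedge (z j') m S') =
      [&& j' == j, S' == S & alpha' == alpha]%:R].
Proof.
have [g [gE [D DP]]] := chart_derivations.
have nthS (T : {set option 'I_n}) (l : 'I_m) : #|T| = m -> nth None (enum T) l \in T.
  by move=> Tm; rewrite -mem_enum mem_nth // -cardE Tm.
have /fin_all_exists2[th thL thE] (l : 'I_m) : exists2 th : kaehler A -> C,
    semilinear g th & forall a, th (kdiff a) = D (nth None (enum S) l) a.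
  by apply: kaehler_lift; have [] := DP _ (nthS S l Sm).
have [F [FD FZ] FE] := wedge_lift_det thL.
exists (fun v => low_coef (F v)); split=> [v w|c v|j' S' alpha' a Sm' aj aE].
- by rewrite FD low_coefD.
- have gc : g c%:A = c%:A by rewrite linearZ rmorph1.
  by rewrite FZ /= gc -low_coefZ -scalerAl mul1r.
rewrite FZ /= /chart_wedge FE.
have [jE|jj'] := eqVneq j' j; last first.
  have -> : g a = 0 by rewrite (gE a 0) ?raddf0 // aj // eq_sym.
  by rewrite mul0r -(raddf0 pi) low_coefE mcoeff0.
move: aE; rewrite jE => aE; rewrite (gE _ _ aE).
set Mx := \matrix_(_, _) _.
have MxE l l' : Mx l l' = (nth None (enum S) l == nth None (enum S') l')%:R.
  rewrite mxE ffunE thE; case: (DP _ (nthS S l Sm)) => _ -> //.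
have [SS'|SS'] := eqVneq S' S.
  have -> : Mx = 1%:M.
    apply/matrixP=> l l'; rewrite MxE mxE SS' nth_uniq ?enum_uniq //.
    - by rewrite -cardE Sm.
    - by rewrite -cardE Sm.
  by rewrite det1 mulr1 low_coefE mcoeffX.
(* Distinct sets of the same size: an element of [S] outside [S'] produces a zero row. *)
have [l lS lS'] : exists2 l, l \in S & l \notin S'.
  apply/subsetPn; apply: contra SS' => sub.
  by rewrite eq_sym eqEcard sub Sm Sm' leqnn.
have lt : (index l (enum S) < m)%N by rewrite -Sm cardE index_mem mem_enum.
rewrite (expand_det_row _ (Ordinal lt)) big1 ?mulr0.
  by rewrite -(raddf0 pi) low_coefE mcoeff0.
move=> l' _; rewrite MxE /= nth_index ?mem_enum //; case: eqP => [E|_].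
  by rewrite E nthS in lS'.
by rewrite mul0r.
Qed.

End Coordinate.
End Coordinates.

(** * Dimension of the pieces of Omega^m in large degree *)

Definition ffun_mnm (n B : nat) (f : {ffun 'I_n -> 'I_B}) : 'X_{1..n} :=
  [multinom (f i : nat) | i < n].

Lemma ffun_mnm_inj n B : injective (@ffun_mnm n B).
Proof.
move=> f g /mnmP E; apply/ffunP=> i; apply: val_inj.
by have := E i; rewrite !mnmE.
Qed.

Section HilbertFunction.
Variables (K : fieldType) (A : comAlgType K) (G : grading A).
Variables (r : nat) (x : 'I_r -> A) (Gx : generated_in_degree1 G x).
Variables (n s : nat) (k : 'I_n -> 'I_s -> nat).
Hypothesis k_gt0 : forall i j, (0 < k i j)%N.
Variable Q : 'I_s -> idealr {mpoly K[n]}.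
Hypothesis Qk : forall j, generated_by_powers (k^~ j) (Q j).
Variable phi : forall j, {lrmorphism A -> quot_alg (Q j)}.
Hypothesis phi_inj : forall d a, G d a -> (forall j, phi j a = 0) -> a = 0.
Variable N0 : nat.
Hypothesis phi_surj : forall e j u, (N0 <= e)%N ->
  exists a, [/\ G e a, supported_at phi j a & phi j a = u].
Variable eul : A -> A.
Hypothesis eulD : derivation_along id eul.
Hypothesis eul_homog : forall d a, G d a -> eul a = d%:R *: a.
Variables (m B : nat) (kB : forall i j, (k i j <= B)%N).

(** Exponents are taken in ['I_B] to have a finite index set; [B] is any common bound of the
    k_ij. *)
Definition basis_index :=
  [set t : 'I_s * {set option 'I_n} * {ffun 'I_n -> 'I_B} | (#|t.1.2| == m) &&
    [forall i, t.2 i < reduced_exp K k t.1.1 t.1.2 i]%N].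

(** Two consecutive integers cannot both vanish in K. *)
Lemma invertible_degree : exists2 N, (N0 <= N)%N & N%:R != 0 :> K.
Proof.
have [N0K|N0K] := eqVneq (N0%:R : K) 0; last by exists N0.
by exists N0.+1 => //; rewrite -natr1 N0K add0r oner_eq0.
Qed.

Lemma exists_charts N : (N0 <= N)%N -> exists z : 'I_s -> option 'I_n -> A,
  [/\ forall j l, G N (z j l), forall j l, supported_at phi j (z j l) &
    forall j l, phi j (z j l) = if l is Some i then quot_pi (Q j) 'X_i else 1].
Proof.
move=> le; have H (t : 'I_s * option 'I_n) : exists a, [/\ G N a,
    supported_at phi t.1 a &
    phi t.1 a = if t.2 is Some i then quot_pi (Q t.1) 'X_i else 1].
  exact: phi_surj.
have /fin_all_exists[z zP] := H.
by exists (fun j l => z (j, l)); split=> j l; have [] := zP (j, l).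
Qed.

Lemma hilbert_function_kaehler : exists E0, forall e, (E0 <= e)%N ->
  dim_eq (ext_gr G (kaehler_gr G) (m := m) e) #|basis_index|.
Proof.
have [N N0N N_neq0] := invertible_degree.
have [z [Gz zj phi_z]] := exists_charts N0N.
have [c Hc] : exists c, forall j i, chart_span_at G N (z j) c 1 (kdiff (x i)).
  have H (t : 'I_s * 'I_r) : exists c, chart_span_at G N (z t.1) c 1 (kdiff (x t.2)).
    have [Gx1 _] := Gx.
    exact: (chart_span_kdiff Qk phi_inj phi_surj N0N N_neq0 (Gz t.1) (zj t.1)
      (phi_z t.1) (Gx1 t.2)).
  have /fin_all_exists[c cP] := H; exists (\max_t c t) => j i.
  by apply: chart_span_up (cP (j, i)); [apply: Gz | apply: leq_bigmax].
(* [E1] leaves room for the cofactors in the relations on d y_ij; [m * N] and [m] are the degrees of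
   wedges of the d z and of the d x, and [c.+1 * m * N] is that of the power of eps_j needed to
   rewrite the latter through the former. *)
pose E1 := (N0 + B.+1 * N)%N; exists (E1 + m * N + m + c.+1 * m * N)%N => e le_e.
have le1 : (E1 + m * N <= e)%N by apply: leq_trans le_e; rewrite -addnA leq_addr.
have mNe : (m * N <= e)%N by apply: leq_trans le1; rewrite leq_addl.
pose e' := (e - m * N)%N.
have E1e' : (E1 <= e')%N by rewrite leq_subRL // addnC.
have N0e' : (N0 <= e')%N by apply: leq_trans E1e'; apply: leq_addr.
have ee' : e = (e' + m * N)%N by rewrite subnK.
have /fin_all_exists[g gP] (t : 'I_s * {set option 'I_n} * {ffun 'I_n -> 'I_B}) :
    exists a, [/\ G e' a, supported_at phi t.1.1 a &
      phi t.1.1 a = quot_pi (Q t.1.1) 'X_[ffun_mnm t.2]] by apply: phi_surj.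
pose bas t := g t *: chart_wedge (z t.1.1) m t.1.2.
pose b (i : 'I_#|basis_index|) := bas (enum_val i).
exists b; split.
  move=> a a0 i; have := enum_valP i; rewrite inE => /andP[/eqP Sm /forallP lt].
  have lt' l : (ffun_mnm (enum_val i).2 l <
      reduced_exp K k (enum_val i).1.1 (enum_val i).1.2 l)%N.
    by rewrite mnmE; apply: lt.
  have [f [fD fZ fE]] := coordinate Qk N_neq0 Gz phi_z eulD eul_homog Sm lt'.
  have f0 : f 0 = 0.
    by rewrite -(scale0r (0 : ext_power (kaehler A) m)) -(scale0r 1) fZ mul0r.
  have := congr1 f a0; rewrite f0 (big_morph _ fD f0) (bigD1 i) //= big1 => [|i' ii'].
    have [_ gj gE] := gP (enum_val i).
    by rewrite addr0 fZ /b /bas (fE _ _ _ _ Sm gj gE) !eqxx mulr1.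
  have := enum_valP i'; rewrite inE => /andP[/eqP Sm' _].
  have [_ gj gE] := gP (enum_val i').
  rewrite fZ /b /bas (fE _ _ _ _ Sm' gj gE).
  case: and3P => [[/eqP E1' /eqP E2 /eqP E3]|_].
    case/negP: ii'; apply/eqP/enum_val_inj.
    case: (enum_val i') (enum_val i) E1' E2 E3 => [[j' S'] f'] [[j S] f''] /= -> ->.
    by move/ffun_mnm_inj->.
  by rewrite mulr0.
move=> v; pose R v := exists c0, v = \sum_i (c0 i)%:A *: b i; rewrite -/(R v).
have R0 : R 0.
  by exists (fun=> 0); rewrite big1 // => i _; rewrite scale0r scale0r.
have RL c0 v1 v2 : R v1 -> R v2 -> R (c0%:A *: v1 + v2).
  move=> [c1 ->] [c2 ->]; exists (fun i => c0 * c1 i + c2 i).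
  rewrite scaler_sumr -big_split; apply: eq_bigr => i _ /=.
  by rewrite scalerDl -scalerA scalerA -scalerAl mul1r scalerDl.
have RD v1 v2 : R v1 -> R v2 -> R (v1 + v2).
  by move=> R1 R2; have := RL 1 _ _ R1 R2; rewrite !scale1r.
split; last first.
  move=> [c0 ->]; apply: add_span_sum => i _; apply: add_span_gen.
  rewrite /b /bas scalerA /chart_wedge; have [Gg _ _] := gP (enum_val i).
  exists (0 + e')%N, (fun=> N); do 2 eexists.
  split; [|exact: gr_M (gr_const G (c0 i)) Gg| |reflexivity].
    by rewrite add0n sum_nat_const card_ord; apply/esym; exact: ee'.
  move=> l; rewrite ffunE; apply: add_span_gen; exists 0%N, N, 1.
  exists (z (enum_val i).1.1 (nth None (enum (enum_val i).1.2) l)).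
  by rewrite scale1r; split=> //; apply: gr_1.
move=> /(ext_gr_generators Gx); move: v; apply: add_span_ind => //.
move=> v [d [a [h [dm Ga ->]]]].
pose d' := (d - c.+1 * m * N)%N.
have led : (E1 + m * N + c.+1 * m * N <= d)%N.
  by rewrite -(leq_add2r m) dm addnAC.
have led' : (c.+1 * m * N <= d)%N by apply: leq_trans led; apply: leq_addl.
have dd' : d = (d' + c.+1 * m * N)%N by rewrite subnK.
have /fin_all_exists[q qP] (j : 'I_s) : exists a', [/\ G d' a', supported_at phi j a' &
    phi j a' = phi j a].
  apply: phi_surj; rewrite -(leq_add2r (c.+1 * m * N)) -dd'.
  by apply: leq_trans led; rewrite leq_add2r -addnA leq_addr.
(* Both sides have the same value at every point because eps_j has value 1. This splits [a] into
   forms supported at single points and exhibits the power of eps_j that [wedge_generators_span]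
   consumes. *)
have aE : a = \sum_j q j * z j None ^+ c.+1 ^+ m.
  apply/eqP; rewrite -subr_eq0; apply/eqP; apply: (phi_inj (d := d)) => [|j].
    apply: gr_add Ga (gr_opp _); apply: gr_sum => j _; have [Gq _ _] := qP j.
    rewrite dd'; apply: gr_M => //.
    by rewrite -exprM; apply: gr_exp.
  rewrite rmorphB rmorph_sum (bigD1 j) //= big1 => [|j' jj'].
    have [_ _ qE] := qP j.
    by rewrite addr0 rmorphM !rmorphXn /= phi_z !expr1n mulr1 qE subrr.
  have [_ qj _] := qP j'.
  by rewrite rmorphM /= qj ?mul0r // eq_sym.
rewrite aE scaler_suml; apply: (big_ind R) => // j _; have [Gq qj _] := qP j.
have dE : (d' + m * (1 + c * N) = e')%N.
  rewrite /e' -dm dd' mulnDr muln1 mulSn !mulnDl.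
  have -> : (d' + (m * N + c * m * N) + m = d' + (m + m * (c * N)) + m * N)%N by ring.
  by rewrite addnK.
refine (wedge_generators_span Qk phi_inj phi_surj (Gz j) (zj j) (phi_z j) (k_gt0^~ j)
  R0 RL _ _ N0e' h (Hc j) dE Gq qj).
- move=> S alpha a' Sm lt Ga' aj' a'E.
  have ltB i : (alpha i < B)%N.
    by apply: leq_trans (lt i) (leq_trans (reduced_exp_le _ _ _ _ _) (kB i j)).
  pose f : {ffun 'I_n -> 'I_B} := [ffun i => Ordinal (ltB i)].
  have fE : ffun_mnm f = alpha by apply/mnmP=> i; rewrite mnmE ffunE.
  pose t := (j, S, f).
  have tB : t \in basis_index.
    by rewrite inE Sm eqxx; apply/forallP => i; rewrite ffunE /= lt.
  have -> : a' = g t.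
    have [Gg gj gE] := gP t.
    by apply: (supported_ext phi_inj Ga' Gg aj' gj); rewrite gE a'E /= fE.
  exists (fun i => (i == enum_rank_in tB t)%:R).
  rewrite (bigD1 (enum_rank_in tB t)) //= eqxx big1 => [|i /negPf->]; last first.
    by rewrite scale0r scale0r.
  by rewrite !scale1r addr0 /b enum_rankK_in.
- by move=> i; apply: leq_trans E1e'; rewrite leq_add2l leq_mul2r ltnS kB orbT.
Qed.

End HilbertFunction.

(** * Homogeneous components and existence of homogeneous primes *)

Section HomogeneousPrimes.
Variables (K : fieldType) (A : comAlgType K) (G : grading A).

(* The coaction [a |-> \sum_i a_i 'X^i], with [a_i] the component of degree
   [i] of [a]: it turns statements on components into statements on
   coefficients of polynomials. *)
Lemma exists_components (a : A) :
  exists2 q : {poly A}, forall i, G i q`_i & q.[1] = a.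
Proof.
have [N [f [Gf ->]]] := gr_decomp G a; exists (\poly_(i < N) f i).
  by move=> i; rewrite coef_poly; case: ifP => _ //; apply: gr_0.
by rewrite horner_poly; apply: eq_bigr => i _; rewrite expr1n mulr1.
Qed.

Lemma components_unique (q1 q2 : {poly A}) :
  (forall i, G i q1`_i) -> (forall i, G i q2`_i) -> q1.[1] = q2.[1] -> q1 = q2.
Proof.
move=> G1 G2 E; apply/polyP => i; apply/eqP; rewrite -subr_eq0 -coefB.
have [le|lt] := leqP (size (q1 - q2)) i; first by rewrite nth_default.
apply/eqP; move: i lt; apply: (gr_direct (g := G)) => [i|].
  by rewrite coefB; apply: gr_add => //; apply: gr_opp.
have := horner_coef (q1 - q2) 1; rewrite hornerD hornerN E subrr => H; rewrite [RHS]H.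
by apply: eq_bigr => i _; rewrite expr1n mulr1.
Qed.

Definition components a : {poly A} := sval (cid2 (exists_components a)).

Lemma gr_components a i : G i (components a)`_i.
Proof. by rewrite /components; case: cid2. Qed.

Lemma components_horner a : (components a).[1] = a.
Proof. by rewrite /components; case: cid2. Qed.

Lemma componentsE a (q : {poly A}) : (forall i, G i q`_i) -> q.[1] = a -> components a = q.
Proof.
move=> Gq qa; apply: components_unique => //; first exact: gr_components.
by rewrite components_horner.
Qed.

Lemma components_lin (c : A) a b : G 0%N c ->
  components (c * a + b) = c *: components a + components b.
Proof.
move=> Gc; apply: componentsE => [i|].
  rewrite coefD coefZ; apply: gr_add (gr_components _ _).
  by rewrite -[i]add0n; apply: gr_M => //; apply: gr_components.
by rewrite hornerD hornerZ !components_horner.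
Qed.

Lemma componentsD a b : components (a + b) = components a + components b.
Proof. by have := components_lin a b (gr_1 G); rewrite mul1r scale1r. Qed.

Lemma componentsM a b : components (a * b) = components a * components b.
Proof.
apply: componentsE => [i|]; last by rewrite hornerM !components_horner.
rewrite coefM; apply: gr_sum => -[l /= lt] _.
by rewrite -{1}(subnKC (ltnSE lt)); apply: gr_M; apply: gr_components.
Qed.

Lemma components_homog d a : G d a -> components a = a *: 'X^d.
Proof.
move=> Ga; apply: componentsE => [i|]; last by rewrite hornerZ hornerXn expr1n mulr1.
by rewrite coefZ coefXn; case: eqP => [->|_]; rewrite ?mulr1 ?mulr0 //; apply: gr_0.
Qed.

Lemma components0 : components 0 = 0.
Proof. by rewrite (components_homog (gr_0 G 0)) scale0r. Qed.

(* By Zorn's lemma there is a prime avoiding the powers of [y]; the elements all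
   of whose components lie in it form a homogeneous prime. *)
Lemma exists_proj_point (J : A -> Prop) (y : A) :
  J 0 -> (forall a b, J a -> J b -> J (a + b)) -> (forall a b, J b -> J (a * b)) ->
  (forall c, ~ J (y ^+ c)) -> G 1%N y ->
  exists pt : proj_point G, forall d a, G d a -> J a -> a \in pt.
Proof.
move=> J0 JD JM Jy Gy.
(* Containment of [J] is required only of nonempty [X], because the union of the empty chain is
   empty. *)
pose ideal (X : A -> Prop) := [/\ forall a b, X a -> X b -> X (a + b),
  forall a b, X b -> X (a * b), forall a b, X a -> J b -> X b & forall c, ~ X (y ^+ c)].
have [|X [[XD XM XJ Xy] Xmax]] := @classical_sets.Zorn_bigcup A ideal.
  move=> F Fideal Ftot; split.
  - move=> a b [X1 F1 X1a] [X2 F2 X2b].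
    have [[D1 _ _ _] [D2 _ _ _]] := (Fideal _ F1, Fideal _ F2).
    by have [s|s] := Ftot _ _ F1 F2; [exists X2 => //; apply: D2 => //; apply: s
      | exists X1 => //; apply: D1 => //; apply: s].
  - by move=> a b [X1 F1 X1b]; exists X1 => //; have [_ + _ _] := Fideal _ F1; apply.
  - move=> a b [X1 F1 X1a] Jb; exists X1 => //.
    by have [_ _ + _] := Fideal _ F1; apply; [exact: X1a|].
  - by move=> c [X1 F1]; have [_ _ _] := Fideal _ F1; apply.
(* A maximal [X] without 0 would be empty, and [J] would be strictly larger. *)
have X0 : X 0.
  apply: contrapT => nX0; apply: (Xmax J); last by split.
  split=> [a Xa|/(_ 0 J0)//]; case: nX0.
  by rewrite -(mul0r a); apply: XM.
have Xprime u v : X (u * v) -> X u \/ X v.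
  move=> Xuv.
  have ext w : ~ X w -> exists c a b, X a /\ y ^+ c = a + b * w.
    move=> Xw; apply: contrapT => nex.
    apply: (Xmax (fun e => exists a b, X a /\ e = a + b * w)).
      split=> [a Xa|sub]; first by exists a, 0; rewrite mul0r addr0.
      by apply: Xw; apply: sub; exists 0, 1; rewrite mul1r add0r.
    split=> [e f [a [b [Xa ->]]] [a' [b' [Xa' ->]]]|e f [a [b [Xa ->]]]|e f _ Jf|
        c [a [b [Xa E]]]].
    - exists (a + a'), (b + b'); split; [exact: XD | ring].
    - by exists (e * a), (e * b); split; [exact: XM | ring].
    - by exists f, 0; split; [apply: XJ X0 Jf | rewrite mul0r addr0].
    - by apply: nex; exists c, a, b.
  apply: contrapT => /not_orP[/ext[c [a [b [Xa E]]]] /ext[c' [a' [b' [Xa' E']]]]].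
  apply: (Xy (c + c')%N); rewrite exprD E E'.
  have -> : (a + b * u) * (a' + b' * v) =
    (a' + b' * v) * a + (b * u * a' + b * b' * (u * v)) by ring.
  by apply: (XD); [exact: (XM) | apply: XD; exact: (XM)].
have XN a : X a -> X (- a) by rewrite -mulN1r; apply: XM.
pose S : {pred A} := fun a => `[< forall i, X (components a)`_i >].
have SP a : reflect (forall i, X (components a)`_i) (a \in S) by apply: asboolP.
have nSP a : a \notin S -> exists i, ~ X (components a)`_i.
  by move=> /negP aS; apply/existsNP => /SP.
have Xsum (I : Type) (r : seq I) (P : pred I) (F : I -> A) :
    (forall i, P i -> X (F i)) -> X (\sum_(i <- r | P i) F i).
  by move=> H; apply: (big_ind X).
have Sideal : idealr_closed S.
  split; first by apply/SP => i; rewrite components0 coef0.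
    apply/negP => /SP/(_ 0%N); rewrite (components_homog (gr_1 G)) coefZ coefXn mulr1.
    by rewrite -(expr0 y); apply: Xy.
  move=> a u v /SP Su /SP Sv; apply/SP => i.
  rewrite componentsD coefD componentsM coefM; apply: XD => //.
  by apply: Xsum => l _; apply: XM.
have Sprime : prime_idealr_closed S.
  move=> u v /SP Suv; apply: contraT; rewrite negb_or.
  case/andP => /nSP Su /nSP Sv.
  have ex w : (exists i, ~ X (components w)`_i) ->
      exists2 i, ~ X (components w)`_i & forall l, (l < i)%N -> X (components w)`_l.
    move=> [i Hi]; have H : exists i, ~~ `[< X (components w)`_i >].
      by exists i; apply/asboolPn.
    case: (ex_minnP H) => m /asboolPn Hm mmin; exists m => // l lm.
    apply: contrapT => /asboolPn /mmin; by rewrite leqNgt lm.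
  have [i Xi ilt] := ex _ Su; have [j Xj jlt] := ex _ Sv.
  have := Suv (i + j)%N; rewrite componentsM coefM.
  have lt : (i < (i + j).+1)%N by rewrite ltnS leq_addr.
  (* Here i and j are the lowest degrees of components outside X, so every other term of the
     coefficient of degree i + j has a factor of lower degree, which lies in X. *)
  rewrite (bigD1 (Ordinal lt)) //= addKn; set t := \sum_(_ | _) _ => H.
  have Xt : X t.
    apply: Xsum => l li; have [ltl|gtl|E] := ltngtP l i.
    - by rewrite mulrC; apply: XM; apply: ilt.
    - by apply: XM; apply: jlt; rewrite ltn_subLR ?ltn_add2r // -ltnS ltn_ord.
    - by case/eqP: li; apply: val_inj.
  have /Xprime[] // : X ((components u)`_i * (components v)`_j).
  by rewrite -[_ * _](addrK t); apply: XD => //; apply: XN.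
pose p : prime_idealr A := HB.pack S (isIdealr.Build A S Sideal)
  (isPrimeIdealrClosed.Build A S Sprime).
have phom : homogeneous_ideal G p.
  move=> N f Gf /SP Xf i iN; apply/SP => l.
  rewrite (components_homog (Gf i)) coefZ coefXn; case: eqP => _; rewrite ?mulr0 //.
  have := Xf i; suff -> : components (\sum_(i < N) f i) = \poly_(i < N) f i.
    by rewrite coef_poly iN mulr1.
  apply: componentsE => [{}l|].
    by rewrite coef_poly; case: ifP => _ //; apply: gr_0.
  by rewrite horner_poly; apply: eq_bigr => l' _; rewrite expr1n mulr1.
have prel : exists d a, [/\ (0 < d)%N, G d a & a \notin p].
  exists 1%N, y; split=> //; apply/negP => /SP/(_ 1%N).
  rewrite (components_homog Gy) coefZ coefXn mulr1.
  by rewrite -(expr1 y); apply: Xy.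
exists (ProjPoint phom prel) => d a Ga Ja; apply/SP => i.
rewrite (components_homog Ga) coefZ coefXn; case: eqP => _; rewrite ?mulr0 ?mulr1 //.
exact: XJ X0 Ja.
Qed.

End HomogeneousPrimes.

(** * Homogeneous fractions and dehomogenization *)

Lemma dhomogU (K : fieldType) (n : nat) (i : 'I_n) :
  ('X_i : {mpoly K[n]}) \is 1.-homog.
Proof. by rewrite dhomogX; apply/eqP/mdeg1. Qed.

Lemma homog_ind (K : fieldType) (n : nat) (R : nat -> {mpoly K[n]} -> Prop) :
  (forall d, R d 0) -> (forall d c f g, R d f -> R d g -> R d (c *: f + g)) ->
  R 0%N 1 ->
  (forall d i (f : {mpoly K[n]}), f \is d.-homog -> R d f -> R d.+1 ('X_i * f)) ->
  forall d (f : {mpoly K[n]}), f \is d.-homog -> R d f.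
Proof.
move=> R0 RL R1 RX.
have RM m : R (mdeg m) 'X_[m].
  move dE : (mdeg m) => d; elim: d m dE => [|d IH] m dE.
    by move/eqP: dE; rewrite mdeg_eq0 => /eqP->; rewrite mpolyX0.
  have [i mi] : exists i, m i != 0%N.
    apply/existsP; rewrite -negb_forall; apply: contra_eqN dE => /forallP m0.
    suff -> : m = 0%MM by rewrite mdeg0.
    by apply/mnmP => i; rewrite mnm0E; apply/eqP.
  have mE : m = (U_(i) + (m - U_(i)))%MM by rewrite addmC submK // lep1mP.
  have d1 : mdeg (m - U_(i)) = d.
    by move: dE; rewrite {1}mE mdegD mdeg1 add1n => -[].
  by rewrite mE mpolyXD; apply: RX (IH _ d1); rewrite dhomogX; apply/eqP.
move=> d f /dhomog_mf fd; rewrite (mpolyE f) big_seq.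
apply: (big_ind (R d)) => // [g h Rg Rh|m mf].
  by rewrite -[g]scale1r; apply: RL.
by rewrite -[_ *: _]addr0; apply: RL => //; rewrite -(fd m mf); apply: RM.
Qed.

Section FractionRing.
Variables (K : fieldType) (A : comAlgType K) (G : grading A) (pt : proj_point G).

(** [insubd] makes the fraction total: an inadmissible pair gives zero, and [frac_ok] excludes this
    case. *)
Definition frac (a b : A) : local_ring pt :=
  lr_pi (insubd (hfrac_0 pt) (a, b)).

Definition frac_ok (a b : A) : Prop := (exists d, G d a /\ G d b) /\ b \notin pt.

Lemma frac_val a b : frac_ok a b -> hfrac_val (insubd (hfrac_0 pt) (a, b)) = (a, b).
Proof. by case=> H1 H2; rewrite insubdK //; apply/andP; split=> //; apply/asboolP. Qed.

Lemma fracP a b c e : frac_ok a b -> frac_ok c e -> reflect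
  (exists d h, [/\ G d h, h \notin pt & h * (a * e - c * b) = 0]) (frac a b == frac c e).
Proof.
move=> ab ce; apply: (iffP eqP) => [/lr_piP/asboolP|[d [h [Gh ht h0]]]].
  by rewrite !frac_val.
by apply/lr_piP/asboolP; exists d, h; rewrite !frac_val.
Qed.

Lemma frac_eq a b c e : frac_ok a b -> frac_ok c e -> a * e = c * b -> frac a b = frac c e.
Proof.
move=> ab ce E; apply/eqP/fracP => //; exists 0%N, 1.
by split; [apply: gr_1 | apply: pt_notin1 | rewrite E subrr mulr0].
Qed.

Lemma frac_okD a b c e : frac_ok a b -> frac_ok c e -> frac_ok (a * e + c * b) (b * e).
Proof.
move=> [[d [Ga Gb]] hb] [[d' [Gc Ge]] he]; split; last exact: pt_notinM.
exists (d + d')%N; split; last exact: gr_M.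
by apply: gr_add; [apply: gr_M | rewrite addnC; apply: gr_M].
Qed.

Lemma frac_okM a b c e : frac_ok a b -> frac_ok c e -> frac_ok (a * c) (b * e).
Proof.
move=> [[d [Ga Gb]] hb] [[d' [Gc Ge]] he]; split; last exact: pt_notinM.
by exists (d + d')%N; split; apply: gr_M.
Qed.

Lemma fracD a b c e : frac_ok a b -> frac_ok c e ->
  frac a b + frac c e = frac (a * e + c * b) (b * e).
Proof.
move=> ab ce; rewrite /frac -[LHS]/(lr_add _ _) lr_addE.
congr lr_pi; apply: val_inj; rewrite [RHS](frac_val (frac_okD ab ce)) /=.
by rewrite !frac_val.
Qed.

Lemma fracM a b c e : frac_ok a b -> frac_ok c e ->
  frac a b * frac c e = frac (a * c) (b * e).
Proof.
move=> ab ce; rewrite /frac -[LHS]/(lr_mul _ _) lr_mulE.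
congr lr_pi; apply: val_inj; rewrite [RHS](frac_val (frac_okM ab ce)) /=.
by rewrite !frac_val.
Qed.

Lemma frac_okZ k a b : frac_ok a b -> frac_ok (k *: a) b.
Proof.
by move=> [[d [Ga Gb]] hb]; split=> //; exists d; split=> //; apply: gr_scale.
Qed.

Lemma fracZ k a b : frac_ok a b -> k *: frac a b = frac (k *: a) b.
Proof.
move=> ab; rewrite /frac -[LHS]/(lr_scale _ _) lr_scaleE.
congr lr_pi; apply: val_inj; rewrite [RHS](frac_val (frac_okZ k ab)) /=.
by rewrite !frac_val.
Qed.

Lemma frac_ok1 : frac_ok 1 1.
Proof. by split; [exists 0%N; split; apply: gr_1 | apply: pt_notin1]. Qed.

Lemma frac1 : frac 1 1 = 1.
Proof. by congr lr_pi; apply: val_inj; rewrite [LHS](frac_val frac_ok1). Qed.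

Lemma frac_ok0 : frac_ok 0 1.
Proof. by split; [exists 0%N; split; [apply: gr_0|apply: gr_1] | apply: pt_notin1]. Qed.

Lemma frac0 : frac 0 1 = 0.
Proof. by congr lr_pi; apply: val_inj; rewrite [LHS](frac_val frac_ok0). Qed.

Lemma frac_num0 b : (exists d, G d b) -> b \notin pt -> frac 0 b = 0.
Proof.
move=> [d Gb] hb; rewrite -frac0; apply: frac_eq; [|exact: frac_ok0|by rewrite !mul0r].
by split=> //; exists d; split=> //; apply: gr_0.
Qed.

Lemma frac_surj y : exists d a b, [/\ G d a, G d b, b \notin pt & y = frac a b].
Proof.
elim/lr_ind: y => u; have [d [Ga Gb]] := hfracP u.
exists d, u.1, u.2; split=> //; first exact: hfrac_den.
by congr lr_pi; rewrite -surjective_pairing valKd.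
Qed.

Lemma notin_exp b d : b \notin pt -> b ^+ d \notin pt.
Proof.
move=> hb; elim: d => [|d IH]; first exact: pt_notin1.
by rewrite exprS; apply: pt_notinM.
Qed.

(** These five properties are what the later arguments retain of the local ring: the value of [xi],
    the kernel on forms, nonunits, units, and every element being a quotient of values. *)
Lemma dehomogenized (B : comAlgType K) (f : {lrmorphism local_ring pt -> B})
    (phi : {lrmorphism A -> local_ring pt}) (xi : A) :
  bijective f -> G 1%N xi -> xi \notin pt ->
  (forall d a, G d a -> phi a = frac a (xi ^+ d)) ->
  [/\ f (phi xi) = 1,
      forall d a, G d a -> f (phi a) = 0 ->
        exists d' h, [/\ G d' h, h \notin pt & h * a = 0],
      forall d a, G d a -> a \in pt -> forall u, f (phi a) * u <> 1,
      forall d a, G d a -> a \notin pt -> exists u, f (phi a) * u = 1 &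
      forall u, exists d a b, [/\ G d a, G d b, b \notin pt & u * f (phi b) = f (phi a)]].
Proof.
move=> [f' fK f'K] Gxi hxi phiE.
have Gx d : G d (xi ^+ d) by rewrite -{1}[d]muln1; apply: gr_exp.
have hx d : xi ^+ d \notin pt by apply: notin_exp.
have ok d a : G d a -> frac_ok a (xi ^+ d) by move=> Ga; split=> //; exists d.
have ok' d a : G d a -> a \notin pt -> frac_ok (xi ^+ d) a.
  by move=> Ga; split=> //; exists d.
have inv d a : G d a -> a \notin pt -> phi a * frac (xi ^+ d) a = 1.
  move=> Ga ha; rewrite (phiE _ _ Ga) fracM //; [|exact: ok|exact: ok'].
  rewrite -frac1; apply: frac_eq; [|exact: frac_ok1|by rewrite mulr1 mul1r mulrC].
  by apply: frac_okM; [apply: ok | apply: ok'].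
split.
- rewrite (phiE _ _ Gxi) expr1 -[RHS](rmorph1 f) -frac1; congr (f _).
  by apply: frac_eq; [rewrite -{2}[xi]expr1; apply: ok|exact: frac_ok1|rewrite mulrC].
- move=> d a Ga f0; have {f0} : phi a = 0 by rewrite -(fK (phi a)) f0 -(rmorph0 f) fK.
  rewrite (phiE _ _ Ga) -frac0 => /eqP/fracP[||d' [h [Gh hh h0]]].
  + exact: ok.
  + exact: frac_ok0.
  by exists d', h; split=> //; move: h0; rewrite mul0r subr0 mulr1.
- move=> d a Ga ha u; rewrite -(f'K u) -rmorphM => fE.
  have {fE} : phi a * f' u = 1 by rewrite -[LHS]fK fE -(rmorph1 f) fK.
  have [d' [c [e [Gc Ge he ->]]]] := frac_surj (f' u).
  have ce : frac_ok c e by split=> //; exists d'.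
  rewrite (phiE _ _ Ga) fracM //; last exact: ok.
  rewrite -frac1 => /eqP/fracP[||d'' [h [Gh hh]]].
  + by apply: frac_okM => //; apply: ok.
  + exact: frac_ok1.
  rewrite mulr1 mul1r => /eqP; rewrite mulrBr subr_eq0 => /eqP E.
  have : h * (xi ^+ d * e) \in pt.
    by rewrite -E mulrCA mulrC idealMr // mulrC idealMr // mulrC.
  by apply/negP; apply: pt_notinM => //; apply: pt_notinM.
- move=> d a Ga ha; exists (f (frac (xi ^+ d) a)).
  by rewrite -rmorphM (inv _ _ Ga ha) rmorph1.
- move=> u; have [d [a [b [Ga Gb hb E]]]] := frac_surj (f' u).
  exists d, a, b; split=> //; rewrite -(f'K u) E -rmorphM; congr (f _).
  have ab : frac_ok a b by split=> //; exists d.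
  rewrite (phiE _ _ Gb) (phiE _ _ Ga) fracM //; last exact: ok.
  apply: frac_eq; [by apply: frac_okM => //; apply: ok|exact: ok|ring].
Qed.

End FractionRing.

Lemma mpoly_lift (K : fieldType) (n : nat) (L : comAlgType K) (h : 'I_n -> L) :
  exists th : {lrmorphism {mpoly K[n]} -> L}, forall i, th 'X_i = h i.
Proof.
pose th0 := mmap (GRing.in_alg L) h.
have thZ : scalable th0 by move=> c p; rewrite /th0 mmapZ /= -scalerAl mul1r.
pose th : {lrmorphism {mpoly K[n]} -> L} := HB.pack th0
  (GRing.RMorphism.on th0) (GRing.isScalable.Build _ _ _ _ th0 thZ).
by exists th => i; rewrite /= /th0 mmapX mmap1U.
Qed.

Lemma mpoly_dehomogenization (K : fieldType) (n : nat) (A : comAlgType K)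
    (G : grading A) (p : {lrmorphism {mpoly K[n]} -> A}) (pt : proj_point G) (xi : A) :
  (forall d f, f \is d.-homog -> G d (p f)) -> G 1%N xi -> xi \notin pt ->
  exists th : {lrmorphism {mpoly K[n]} -> local_ring pt},
    forall d f, f \is d.-homog -> th f = frac pt (p f) (xi ^+ d).
Proof.
move=> pG Gxi hxi.
have Gx d : G d (xi ^+ d) by rewrite -{1}[d]muln1; apply: gr_exp.
have ok d a : G d a -> frac_ok pt a (xi ^+ d).
  by move=> Ga; split; [exists d | apply: notin_exp].
have [th thX] := mpoly_lift (fun i => frac pt (p 'X_i) xi).
(* Homogeneity is carried in the statement because the linear step of [homog_ind] supplies it for
   neither summand. *)
exists th => d f fd; suff [] : f \is d.-homog /\ th f = frac pt (p f) (xi ^+ d) by [].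
move: d f fd; apply: homog_ind.
- move=> d; split; first exact: rpred0.
  by rewrite !rmorph0 frac_num0 //; [exists d | apply: notin_exp].
- move=> d c f g [fd Hf] [gd Hg]; split; first by apply: rpredD => //; apply: rpredZ.
  have [Gf Gg] := (pG _ _ fd, pG _ _ gd).
  rewrite !linearP /= Hf Hg fracZ; last exact: ok.
  rewrite fracD; [|by apply: ok; apply: gr_scale|exact: ok].
  apply: frac_eq; [apply: frac_okD; apply: ok => //; exact: gr_scale| |ring].
  by apply: ok; apply: gr_lin.
- split; first exact: dhomog1.
  by rewrite !rmorph1 expr0 frac1.
- move=> d i f fd [_ Hf]; split; first exact: dhomogM (dhomogU K i) fd.
  have Gf := pG _ _ fd; rewrite !rmorphM /= Hf thX fracM; last exact: ok.
    by rewrite exprS.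
  by have := ok _ _ (pG _ _ (dhomogU K i)); rewrite expr1.
Qed.

(** * The homogeneous coordinate ring *)

Section CoordinateRing.
Variables (K : fieldType) (n : nat) (I : idealr {mpoly K[n.+1]}).
Hypothesis hI : homogeneous_ideal (mpoly_grading K n.+1) I.
Local Notation A := (quot_alg I).
Local Notation G := (quot_grading hI).

Definition coord (i : 'I_n.+1) : A := quot_pi I 'X_i.

Lemma gr_coord i : G 1%N (coord i).
Proof. by exists 'X_i => //; exact: dhomogU. Qed.

Lemma coord_generated : generated_in_degree1 G coord.
Proof.
split; first exact: gr_coord.
move=> R R0 RL R1 RX d a [f fd ->]; move: d f fd; apply: homog_ind.
- by move=> d; rewrite raddf0.
- by move=> d c f g Rf Rg; rewrite quot_piD quot_piZ; apply: RL.
- by rewrite quot_pi1.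
- by move=> d i f fd Rf; rewrite quot_piM; apply: RX => //; exists f.
Qed.

Lemma homogeneous_subset (f : {mpoly K[n.+1]}) (C : zmodType)
    (D : {mpoly K[n.+1]} -> C) : D 0 = 0 -> {morph D : f g / f + g} ->
  (forall d g, g \is d.-homog -> g \in I -> D g = 0) -> f \in I -> D f = 0.
Proof.
move=> D0 DD Dhom fI; have [N [g [Gg fE]]] := mpoly_piece_decomp f.
rewrite fE (big_morph D DD D0) big1 // => i _.
apply: (Dhom i); first exact: Gg.
by apply: (hI Gg _ (ltn_ord i)); rewrite -fE.
Qed.

(** The polynomial Euler derivation multiplies a form of degree d by d, so it preserves a
    homogeneous ideal and descends. *)
Lemma exists_euler : exists2 eul : A -> A, derivation_along id eul &
  forall d a, G d a -> eul a = d%:R *: a.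
Proof.
have eD := derivation_quot_pi I (euler_derivation K n.+1).
have e0 f : f \in I -> quot_pi I (euler f) = 0.
  apply: (homogeneous_subset (D := fun f => quot_pi I (euler f))) => [|f' g|d g gd gI].
  - by rewrite -(scale0r (0 : {mpoly K[n.+1]})) eulerZ scale0r raddf0.
  - by have [-> _ _] := eD.
  rewrite (euler_homog gd) quot_piZ (_ : quot_pi I g = 0) ?scaler0 //.
  by apply/eqP; rewrite quot_pi_eq0.
have [eul eulD eulE] := quot_derivation (h := id) eD e0 (fun=> erefl).
exists eul => // d a [f fd ->]; rewrite eulE (euler_homog fd).
exact: quot_piZ.
Qed.

Lemma dehomogenization (pt : proj_point G) (xi : A) : G 1%N xi -> xi \notin pt ->
  exists phi : {lrmorphism A -> local_ring pt},
    forall d a, G d a -> phi a = frac pt a (xi ^+ d).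
Proof.
move=> Gxi hxi; pose p : {lrmorphism {mpoly K[n.+1]} -> A} := quot_pi I.
have pG d f : f \is d.-homog -> G d (p f) by exists f.
have [th thE] := mpoly_dehomogenization pG Gxi hxi.
have [|phi phiE] := quot_lift (I := I) (g := th).
  move=> f fI; apply: homogeneous_subset fI => [||d g gd gI].
  - exact: rmorph0.
  - exact: rmorphD.
  have p0 : p g = 0 by apply/eqP; rewrite quot_pi_eq0.
  rewrite (thE _ _ gd) p0 frac_num0 //; last exact: notin_exp.
  by exists d; rewrite -{1}[d]muln1; apply: gr_exp.
by exists phi => d a [f fd ->]; rewrite phiE; apply: thE.
Qed.

(** If x_i^(c_i) killed [a] for every i, so would every monomial of degree 1 + sum of the c_i, since
    by pigeonhole some exponent reaches c_i; saturation would then give a = 0. *)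
Lemma saturated_annihilator (hsat : saturated I) d (a : A) : G d a -> a != 0 ->
  exists i, forall c, coord i ^+ c * a != 0.
Proof.
move=> [f fd ->] a0; apply: contrapT => /forallNP H.
have {}H i : exists c, coord i ^+ c * quot_pi I f = 0.
  by have /existsNP[c /negP/negPn/eqP E] := H i; exists c.
have {H} /fin_all_exists[c cP] := H.
case/negP: a0; rewrite quot_pi_eq0.
apply: (hsat _ (\sum_i c i).+1) => g gd.
rewrite (mpolyE g) mulr_suml big_seq; apply: rpred_sum => m /(dhomog_mf gd) md.
have {}md : mdeg m = (\sum_i c i).+1 := md.
have [i le] : exists i, (c i <= m i)%N.
  apply: contrapT => /forallNP H; have : (mdeg m <= \sum_i c i)%N.
    by rewrite mdegE; apply: leq_sum => i _; apply: ltnW; rewrite ltnNge; apply/negP/H.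
  by rewrite md ltnn.
have -> : m = ((m - U_(i) *+ c i) + U_(i) *+ c i)%MM.
  rewrite submK //; apply/mnm_lepP => j; rewrite mulmnE mnm1E.
  by case: eqP => [<-|_]; rewrite ?mul1n ?mul0n.
rewrite mpolyXD -mul_mpolyC -mpolyUn -!mulrA; do 2 apply: idealMr.
by rewrite -quot_pi_eq0 quot_piM rmorphXn cP.
Qed.

End CoordinateRing.

(** * Surjectivity of the charts in large degrees *)

Lemma geometric_inverse (B : comNzRingType) (x : B) d :
  x ^+ d = 0 -> (1 - x) * (\sum_(i < d) x ^+ i) = 1.
Proof. by move=> xd; rewrite -opprB mulNr -subrX1 xd sub0r opprK. Qed.

Section LocalChart.
Variables (K : fieldType) (A B : comAlgType K) (G : grading A).
Hypothesis B_local : forall u : B,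
  nilp u \/ exists2 c : K, c != 0 & nilp (1 - c^-1 *: u).
Variables (phi : {lrmorphism A -> B}) (pt : proj_point G) (xi : A).
Hypotheses (Gxi : G 1%N xi) (phi_xi : phi xi = 1).
Hypothesis phi_nonunit : forall d a, G d a -> a \in pt -> forall u, phi a * u <> 1.
Hypothesis phi_unit : forall d a, G d a -> a \notin pt -> exists u, phi a * u = 1.
Hypothesis phi_frac : forall u,
  exists d a b, [/\ G d a, G d b, b \notin pt & u * phi b = phi a].

Lemma nilp_nonunit (u v : B) : nilp u -> u * v <> 1.
Proof.
move=> [d ud] uv; have := expr1n B d; rewrite -uv exprMn ud mul0r.
by move/eqP; rewrite uv eq_sym oner_eq0.
Qed.

(* A unit of the chart is [c (1 - x)] with [x] nilpotent, so its inverse is a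
   polynomial in it. *)
Lemma chart_inverse a u : phi a * u = 1 -> exists b, phi a * phi b = 1.
Proof.
move=> au; have [/nilp_nonunit/(_ au)//|[c c0 [d xd]]] := B_local (phi a).
pose y := 1 - c^-1 *: a.
have yE : phi y = 1 - c^-1 *: phi a.
  by rewrite rmorphB rmorph1 /= [phi (_ *: _)]linearZ.
exists (c^-1 *: \sum_(i < d) y ^+ i).
rewrite linearZ rmorph_sum /= -scalerAr scalerAl.
under eq_bigr => i _ do rewrite rmorphXn /= yE.
have {1}-> : c^-1 *: phi a = 1 - (1 - c^-1 *: phi a) by rewrite opprB addrC subrK.
exact: geometric_inverse.
Qed.

Lemma chart_surj u : exists a, phi a = u.
Proof.
have [d [a [b [_ Gb hb E]]]] := phi_frac u.
have [v /chart_inverse[b' b'E]] := phi_unit Gb hb.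
by exists (a * b'); rewrite rmorphM /= -E -mulrA b'E mulr1.
Qed.

(** Powers of [xi], which has value 1, raise the components of a lift to any large common degree. *)
Lemma chart_gr_surj_at u : exists M, forall e, (M <= e)%N -> exists2 a, G e a & phi a = u.
Proof.
have [a <-] := chart_surj u; have [M [f [Gf ->]]] := gr_decomp G a.
exists M => e Me; exists (\sum_(i < M) f i * xi ^+ (e - i)).
  apply: gr_sum => i _; rewrite -{1}(subnKC (leq_trans (ltnW (ltn_ord i)) Me)).
  by apply: gr_M => //; rewrite -{1}[(e - i)%N]muln1; apply: gr_exp.
rewrite !rmorph_sum; apply: eq_bigr => i _.
by rewrite /= rmorphM rmorphXn /= phi_xi expr1n mulr1.
Qed.

Lemma chart_nilp d a : G d a -> a \in pt -> nilp (phi a).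
Proof.
move=> Ga ha; have [//|[c c0 [d' xd]]] := B_local (phi a).
have := geometric_inverse xd; rewrite opprB addrC subrK -scalerAl scalerAr.
by move/(phi_nonunit Ga ha).
Qed.

End LocalChart.

(** Finitely many monomials span the quotient, so one bound serves all values. *)
Lemma chart_gr_surj (K : fieldType) (A : comAlgType K) (G : grading A) (n : nat)
    (k : 'I_n -> nat) (Q : idealr {mpoly K[n]}) (phi : {lrmorphism A -> quot_alg Q}) :
  generated_by_powers k Q ->
  (forall u, exists M, forall e, (M <= e)%N -> exists2 a, G e a & phi a = u) ->
  exists M, forall e u, (M <= e)%N -> exists2 a, G e a & phi a = u.
Proof.
move=> Qk surj.
pose b := (\max_i k i)%N.
have /fin_all_exists[M MP] (f : {ffun 'I_n -> 'I_b}) :=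
  surj (quot_pi Q 'X_[ffun_mnm f]).
exists (\max_f M f)%N => e u le; move: u.
apply: (quot_gen_ind Qk) => [|c u v [a Ga <-] [a' Ga' <-]|alpha lt].
- by exists 0; [apply: gr_0 | rewrite rmorph0].
- by exists (c *: a + a'); [apply: gr_lin | rewrite linearP].
have ltb i : (alpha i < b)%N by apply: leq_trans (lt i) (leq_bigmax i).
pose f : {ffun 'I_n -> 'I_b} := [ffun i => Ordinal (ltb i)].
have -> : alpha = ffun_mnm f by apply/mnmP=> i; rewrite mnmE ffunE.
by apply: MP; apply: leq_trans le; apply: leq_bigmax.
Qed.

Section GlobalCharts.
Variables (K : fieldType) (A : comAlgType K) (G : grading A) (s : nat).
Variables (B : 'I_s -> comAlgType K) (phi : forall j, {lrmorphism A -> B j}).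
Hypothesis B_local : forall j (u : B j),
  nilp u \/ exists2 c : K, c != 0 & nilp (1 - c^-1 *: u).
Hypothesis phi_gr_surj : forall j,
  exists M, forall e u, (M <= e)%N -> exists2 a, G e a & phi j a = u.
Variable pt : 'I_s -> proj_point G.
Hypothesis phi_nonunit : forall j d a, G d a -> a \in pt j -> forall u, phi j a * u <> 1.
Hypothesis phi_unit : forall j d a, G d a -> a \notin pt j -> exists u, phi j a * u = 1.
Hypothesis pt_closed : forall j, closed_point (pt j).
Hypothesis pt_inj : forall i j, (pt i : {pred A}) =i (pt j : {pred A}) -> i = j.

(** Distinct closed points are not contained in each other, so some form lies in p_i but not in p_j.
    Its value at p_i is nilpotent, and a power kills it while staying a unit at p_j. *)
Lemma separating_form i j : i != j ->
  exists d g, [/\ G d g, phi i g = 0 & exists u, phi j g * u = 1].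
Proof.
move=> ij; have [h hi hj] : exists2 h, h \in pt i & h \notin pt j.
  apply: contrapT => H; case/negP: ij; apply/eqP/pt_inj.
  have sub : specializes (pt i) (pt j).
    by move=> h hi; apply: contraT => hj; case: H; exists h.
  by move=> h; apply/idP/idP; [apply: sub | apply: (pt_closed sub)].
have [N [f [Gf hE]]] := gr_decomp G h.
have fi l : (l < N)%N -> f l \in pt i.
  by move: l; apply: (pt_homogeneous (p := pt i)) => //; rewrite -hE.
have [l lN fj] : exists2 l, (l < N)%N & f l \notin pt j.
  apply: contrapT => H; case/negP: hj; rewrite hE; apply: rpred_sum => l _.
  by apply: contraT => fl; case: H; exists l.
have [d fd] := chart_nilp (@B_local i) (@phi_nonunit i) (Gf l) (fi l lN).
exists (d * l)%N, (f l ^+ d); split; first exact: gr_exp.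
  by rewrite rmorphXn.
by apply: (phi_unit (d := d * l)); [apply: gr_exp | apply: notin_exp].
Qed.

Lemma localizing_form j : exists d g, [/\ G d g,
  forall i, i != j -> phi i g = 0 & exists u, phi j g * u = 1].
Proof.
have H i : exists g : nat * A, [/\ G g.1 g.2, i != j -> phi i g.2 = 0 &
    exists u, phi j g.2 * u = 1].
  have [->|ij] := eqVneq i j.
    by exists (0%N, 1); split=> //; [apply: gr_1|exists 1; rewrite rmorph1 mulr1].
  by have [d [g [Gg gi gj]]] := separating_form ij; exists (d, g).
have /fin_all_exists[g gP] := H; exists (\sum_i (g i).1)%N, (\prod_i (g i).2); split.
- apply: (big_ind2 (fun d a => G d a)) => [|d a d' a' Ga Ga'|i _].
  + exact: gr_1.
  + exact: gr_M.
  + by have [] := gP i.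
- move=> i ij; rewrite rmorph_prod (bigD1 i) //=; have [_ -> //] := gP i.
  by rewrite mul0r.
- rewrite rmorph_prod.
  apply: (big_ind (fun x => exists u, x * u = 1)) => [|x y [u xu] [v yv]|i _].
  + by exists 1; rewrite mulr1.
  + by exists (u * v); rewrite mulrACA xu yv mulr1.
  + by have [] := gP i.
Qed.

(** A lift at p_j of [u] times the inverse of the value of the localizing form is multiplied by that
    form, which vanishes at the other points. *)
Lemma global_charts_surj : exists N0, forall e j (u : B j), (N0 <= e)%N ->
  exists a, [/\ G e a, forall i, i != j -> phi i a = 0 & phi j a = u].
Proof.
have H j : exists M, forall e u, (M <= e)%N ->
    exists a, [/\ G e a, forall i, i != j -> phi i a = 0 & phi j a = u].
  have [M MP] := phi_gr_surj j.
  have [d [g [Gg g0 [v gv]]]] := localizing_form j.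
  exists (M + d)%N => e u le; have de : (d <= e)%N by apply: leq_trans le; apply: leq_addl.
  have [|a Ga aE] := MP (e - d)%N (u * v); first by rewrite leq_subRL // addnC.
  exists (a * g); split.
  - by rewrite -(subnK de); apply: gr_M.
  - by move=> i ij; rewrite rmorphM /= g0 // mulr0.
  - by rewrite rmorphM /= aE -mulrA [v * _]mulrC gv mulr1.
have /fin_all_exists[M MP] := H; exists (\max_j M j)%N => e j u le.
by apply: MP; apply: leq_trans le; apply: leq_bigmax.
Qed.

End GlobalCharts.

(** * Counting the basis *)

Section Counting.
Local Open Scope nat_scope.

Definition option_set (n : nat) (bS : bool * {set 'I_n}) : {set option 'I_n} :=
  [set l | if l is Some i then i \in bS.2 else bS.1].

Lemma option_set_bij n : bijective (@option_set n).
Proof.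
exists (fun S : {set option 'I_n} => (None \in S, [set i | Some i \in S])) => [[b S]|S].
  by congr (_, _); [rewrite inE | apply/setP=> i; rewrite !inE].
by apply/setP=> -[i|]; rewrite !inE.
Qed.

Lemma card_option_set n (bS : bool * {set 'I_n}) :
  #|option_set bS| = bS.1 + #|bS.2|.
Proof.
case: bS => b S; rewrite -(card_imset S (@Some_inj _)) /=.
rewrite (cardsD1 None) inE; congr (_ + _); apply: eq_card => -[i|].
  rewrite !inE /=; apply/idP/imsetP => [iS|[i' i'S [->]] //].
  by exists i.
by rewrite !inE /=; apply/esym/imsetP => -[].
Qed.

Lemma card_bounded_ffun n B (r : 'I_n -> nat) : (forall i, r i <= B) ->
  #|[set f : {ffun 'I_n -> 'I_B} | [forall i, f i < r i]]| = \prod_i r i.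
Proof.
move=> rB; have -> : #|[set f : {ffun 'I_n -> 'I_B} | [forall i, f i < r i]]| =
    #|(family (fun i => [pred x : 'I_B | x < r i]) : simpl_pred {ffun 'I_n -> 'I_B})|.
  apply: eq_card => f; rewrite inE; apply/forallP/familyP => H i.
    by have := H i; rewrite inE.
  by have := H i; rewrite inE.
rewrite card_family foldrE big_map big_enum; apply: eq_bigr => i _.
by rewrite -sum1_card -(big_ord_widen _ (fun=> 1) (rB i)) sum1_card card_ord.
Qed.

Lemma card_basis_index (K : fieldType) (p : nat) (n s : nat)
    (k : 'I_n -> 'I_s -> nat) (m B : nat) : 0 < m -> (forall i j, k i j <= B) ->
  (forall i j, (p %| k i j) = ((k i j)%:R == 0 :> K)%R) ->
  #|basis_index K k m B| = \sum_(j < s)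
       (\sum_(S : {set 'I_n} | #|S| == m.-1)
          (\prod_(i | i \notin Gamma_set p k S j) k i j) *
          (\prod_(i in Gamma_set p k S j) (k i j - 1))
        + \sum_(S : {set 'I_n} | #|S| == m)
          (\prod_(i | i \notin Gamma_set p k S j) k i j) *
          (\prod_(i in Gamma_set p k S j) (k i j - 1))).
Proof.
move=> m0 kB pk; pose F j S := \prod_i reduced_exp K k j S i.
(* [None] does not enter [reduced_exp], so both inner sums have the same summands. *)
have FE j b (S : {set 'I_n}) : F j (option_set (b, S)) =
    (\prod_(i | i \notin Gamma_set p k S j) k i j) *
    (\prod_(i in Gamma_set p k S j) (k i j - 1)).
  rewrite mulnC /F (bigID (mem (Gamma_set p k S j))) /=.
  congr (_ * _); apply: eq_bigr => i; rewrite /reduced_exp !inE pk.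
    by move=> ->; rewrite subn1.
  by move/negPf->.
transitivity (\sum_(j < s) \sum_(S : {set option 'I_n}) \sum_(f : {ffun 'I_n -> 'I_B})
    if (j, S, f) \in basis_index K k m B then 1 else 0).
  by rewrite -sum1_card big_mkcond !pair_bigA; apply: eq_bigr => -[[]].
apply: eq_bigr => j _.
transitivity (\sum_(S : {set option 'I_n} | #|S| == m) F j S).
  rewrite [RHS]big_mkcond; apply: eq_bigr => S _; case: ifP => [Sm|Sm]; last first.
    by rewrite big1 // => f _; rewrite inE /= Sm.
  rewrite /F -(@card_bounded_ffun n B) => [|i]; last first.
    exact: leq_trans (reduced_exp_le _ _ _ _ _) (kB i j).
  by rewrite -sum1_card [RHS]big_mkcond; apply: eq_bigr => f _; rewrite !inE /= Sm.
rewrite (reindex (@option_set n)); last exact: onW_bij (option_set_bij n).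
transitivity (\sum_(b : bool) \sum_(S : {set 'I_n} | b + #|S| == m) F j (option_set (b, S))).
  rewrite big_mkcond; under [RHS]eq_bigr => b _ do rewrite big_mkcond.
  by rewrite pair_bigA; apply: eq_bigr => -[b S] _; rewrite card_option_set.
rewrite big_bool /=; congr (_ + _); apply: eq_big => S; rewrite ?FE //.
(* A wedge with d eps_j uses m - 1 of the d y_ij; positivity of [m] allows the successor to be
   cancelled. *)
by rewrite add1n -[X in _ == X](prednK m0) eqSS.
Qed.

End Counting.

Lemma dvdn_field_char (K : fieldType) (p k : nat) : field_char K p -> (0 < k)%N ->
  (p %| k)%N = (k%:R == 0 :> K).
Proof.
move=> [pK|[-> K0]] k0; first exact: dvdn_pcharf.
by move/pcharf0P: K0 => K0; rewrite dvd0n K0.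
Qed.

(** * From the scheme to its charts, and conclusion *)

Section HilbertFunctionOfScheme.
Variables (K : fieldType) (A : comAlgType K) (G : grading A).
Variables (r : nat) (x : 'I_r -> A) (Gx : generated_in_degree1 G x).
Variable eul : A -> A.
Hypothesis eulD : derivation_along id eul.
Hypothesis eul_homog : forall d a, G d a -> eul a = d%:R *: a.
Hypothesis dehom : forall (y : proj_point G) xi, G 1%N xi -> xi \notin y ->
  exists phi : {lrmorphism A -> local_ring y},
    forall d a, G d a -> phi a = frac y a (xi ^+ d).
Variables (n s : nat) (pt : 'I_s -> proj_point G) (k : 'I_n -> 'I_s -> nat).
Hypothesis pt_supp : support_enum pt.
Hypothesis k_gt0 : forall i j, (0 < k i j)%N.
Hypothesis pt_monomial : locally_monomial_gorenstein pt k.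
Hypothesis loc_eq0 : forall d a, G d a ->
  (forall j, exists e h, [/\ G e h, h \notin pt j & h * a = 0]) -> a = 0.

Let chart_props (B : comAlgType K) (j : 'I_s) (phi : A -> B) (xi : A) : Prop :=
  [/\ G 1%N xi, phi xi = 1,
    forall d a, G d a -> phi a = 0 -> exists d' h, [/\ G d' h, h \notin pt j & h * a = 0]
  & [/\ forall d a, G d a -> a \in pt j -> forall u, phi a * u <> 1,
    forall d a, G d a -> a \notin pt j -> exists u, phi a * u = 1 &
    forall u, exists d a b, [/\ G d a, G d b, b \notin pt j & u * phi b = phi a]]].

Let exists_chart (B : comAlgType K) j : alg_isomorphic (local_ring (pt j)) B ->
  exists phi : {lrmorphism A -> B}, exists xi, chart_props j phi xi.
Proof.
move=> [f fbij]; have [i hxi] := exists_linear_form Gx (pt j).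
have Gxi : G 1%N (x i) by case: Gx.
have [phi phiE] := dehom Gxi hxi.
have [P1 P2 P3 P4 P5] := dehomogenized fbij Gxi hxi phiE.
by exists [the {lrmorphism _ -> _} of f \o phi]; exists (x i).
Qed.

Lemma hilbert_function_scheme m B : (forall i j, (k i j <= B)%N) ->
  exists E0, forall e, (E0 <= e)%N ->
    dim_eq (ext_gr G (kaehler_gr G) (m := m) e) #|basis_index K k m B|.
Proof.
move=> kB; have /choice[Q QP] := pt_monomial.
have Qk j := (QP j).1.
have /fin_all_exists[phi /fin_all_exists[xi phiP]] j := exists_chart (QP j).2.
have phi_inj d a : G d a -> (forall j, phi j a = 0) -> a = 0.
  move=> Ga a0; apply: (loc_eq0 Ga) => j.
  by have [_ _ H _] := phiP j; exact: H Ga (a0 j).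
have [pt_closed pt_inj _] := pt_supp.
have gr_surj j : exists M, forall e u, (M <= e)%N -> exists2 a, G e a & phi j a = u.
  have [Gxi phi_xi _ [_ phi_unit phi_frac]] := phiP j.
  exact: chart_gr_surj (Qk j)
    (chart_gr_surj_at (quot_local (Qk j)) Gxi phi_xi phi_unit phi_frac).
have phi_nonunit j : forall d a, G d a -> a \in pt j -> forall u, phi j a * u <> 1.
  by have [_ _ _ [H _ _]] := phiP j; exact: H.
have phi_unit j : forall d a, G d a -> a \notin pt j -> exists u, phi j a * u = 1.
  by have [_ _ _ [_ H _]] := phiP j; exact: H.
have [N0 phi_surj] := global_charts_surj (fun j => quot_local (Qk j)) gr_surj
  phi_nonunit phi_unit pt_closed pt_inj.
exact: (hilbert_function_kaehler Gx k_gt0 Qk phi_inj phi_surj eulD eul_homog m kB).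
Qed.

End HilbertFunctionOfScheme.

Section ProjectiveScheme.
Variables (K : fieldType) (n : nat) (I : idealr {mpoly K[n.+1]}).
Hypothesis hI : homogeneous_ideal (mpoly_grading K n.+1) I.
Hypothesis hsat : saturated I.
Local Notation A := (quot_alg I).
Local Notation G := (quot_grading hI).
Hypothesis hdim : proj_dim G 0.

(** A specialization that cannot be reversed would be a chain of length 1. *)
Lemma closed_proj_point (y : proj_point G) : closed_point y.
Proof.
move=> y' yy'; apply: contrapT => y'y; have [_ /(_ 1%N)] := hdim.
suff H : proj_chain G 1 by move/(_ H).
by exists (fun i => if i is 0%N then y else y') => -[|//] _.
Qed.

(** If a is nonzero, saturation gives an x_i no power of which annihilates it. The annihilator then
    has its forms inside some homogeneous prime, that is, inside some p_j, while the local
    hypothesis supplies an annihilating form outside p_j. *)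
Lemma eq0_locally (s : nat) (pt : 'I_s -> proj_point G) d (a : A) :
  (forall y : proj_point G, exists j, (y : {pred A}) =i (pt j : {pred A})) ->
  G d a ->
  (forall j, exists e h, [/\ G e h, h \notin pt j & h * a = 0]) -> a = 0.
Proof.
move=> pt_all Ga loc; apply/eqP; apply: contraT => a0.
have [i ia] := saturated_annihilator hsat Ga a0.
have [|||||y yP] := @exists_proj_point _ _ G (fun b => b * a = 0) (coord I i).
- exact: mul0r.
- by move=> b c ba ca; rewrite mulrDl ba ca addr0.
- by move=> b c ca; rewrite -mulrA ca mulr0.
- by move=> c /eqP; apply/negP.
- exact: gr_coord.
have [j yj] := pt_all y.
have [e [h [Gh hj ha]]] := loc j.
by case/negP: hj; rewrite -yj; apply: yP Gh ha.
Qed.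

End ProjectiveScheme.

Theorem corollary1p4 (K : fieldType) (hK : perfect_field K)
  (p : nat) (hp : field_char K p) (n : nat) (hn : (1 <= n)%N)
  (I : idealr {mpoly K[n.+1]})
  (hI : homogeneous_ideal (mpoly_grading K n.+1) I)
  (hsat : saturated I)
  (hdim : proj_dim (quot_grading hI) 0)
  (s : nat) (pt : 'I_s -> proj_point (quot_grading hI))
  (hsupp : support_enum pt)
  (k : 'I_n -> 'I_s -> nat) (hk : forall i j, (1 <= k i j)%N)
  (hX : locally_monomial_gorenstein pt k)
  (m : nat) (hm : (1 <= m)%N) :
  is_hilbert_poly
    (@ext_gr K (quot_alg I) (quot_grading hI) (kaehler (quot_alg I))
       (kaehler_gr (quot_grading hI)) m)
    ((\sum_(j < s)
       (\sum_(S : {set 'I_n} | #|S| == m.-1)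
          (\prod_(i | i \notin Gamma_set p k S j) k i j) *
          (\prod_(i in Gamma_set p k S j) (k i j - 1))
        + \sum_(S : {set 'I_n} | #|S| == m)
          (\prod_(i | i \notin Gamma_set p k S j) k i j) *
          (\prod_(i in Gamma_set p k S j) (k i j - 1))))%N)%:R%:P.

Proof.
have pt_all (y : proj_point (quot_grading hI)) :
    exists j, (y : {pred quot_alg I}) =i (pt j : {pred quot_alg I}).
  by have [_ _ H] := hsupp; apply: H; apply: closed_proj_point.
have [eul eulD eul_homog] := exists_euler hI.
pose B := (\max_i \max_j k i j)%N.
have kB i j : (k i j <= B)%N.
  by apply: leq_trans (leq_bigmax (F := fun i => \max_j k i j)%N i); apply: leq_bigmax.
have [E0 E0P] := hilbert_function_scheme (coord_generated hI) eulD eul_homog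
  (@dehomogenization _ _ _ hI) hsupp hk hX (fun d a => eq0_locally hsat pt_all (a := a)) m kB.
exists E0 => e /E0P dimE; exists #|basis_index K k m B| => //.
rewrite hornerC (@card_basis_index K p) // => i j.
exact: dvdn_field_char.
Qed.
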